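(* Let $f=\frac1n\sum_{i=1}^n f_i$ with $f_i:\mathbb{R}^d\to\mathbb{R}$ differentiable. Suppose that $f$ is $L$-smooth, each $f_i$ is $L_i$-smooth with $L_{\max}=\max_iL_i$, each $f_i$ is convex, and $f$ is $\mu$-strongly convex with $\mu>0$ and attains its minimum at $x^*\in\mathbb{R}^d$. Run the algorithm EF21-P + DCGD (described in the context) with compressors $\mathcal{C}_i^D\in\mathbb{U}(\omega)$, $\mathcal{C}^P\in\mathbb{B}(\alpha)$, $x^0=w^0$, and $\gamma>0$ satisfying $$\gamma\le\min\left\{\frac{n}{160\,\omega L_{\max}},\ \frac{\alpha}{100L}\right\}.$$ Then for every number of iterations $T$, $$\frac1{2\gamma}\mathrm{E}\left[\|x^T-x^*\|^2\right]+\mathrm{E}\left[f(x^T)-f(x^* )\right]\le\left(1-\frac{\gamma\mu}2\right)^T\left(\frac1{2\gamma}\mathrm{E}\left[\|x^0-x^*\|^2\right]+\left(f(x^0)-f(x^* )\right)\right)+\frac{8\omega}{n\mu}\left(\frac1n\sum_{i=1}^n\|\nabla f_i(x^* )\|^2\right).$$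
   Context: $\|\cdot\|$ is the Euclidean norm. A function is $L$-smooth if it is differentiable with $\|\nabla f(x)-\nabla f(y)\|\le L\|x-y\|$ for all $x,y$; the constants $L$ and $L_i$ denote the smallest such numbers. Fractions with zero denominator in upper bounds on the stepsize are read as $+\infty$. Compressors. For $\alpha\in(0,1]$, $\mathbb{B}(\alpha)$ is the set of (possibly) stochastic mappings $\mathcal{C}:\mathbb{R}^d\to\mathbb{R}^d$ with $\mathrm{E}[\|\mathcal{C}(x)-x\|^2]\le(1-\alpha)\|x\|^2$ for all $x\in\mathbb{R}^d$. For $\omega\ge0$, $\mathbb{U}(\omega)$ is the set of stochastic mappings $\mathcal{C}:\mathbb{R}^d\to\mathbb{R}^d$ with $\mathrm{E}[\mathcal{C}(x)]=x$ and $\mathrm{E}[\|\mathcal{C}(x)-x\|^2]\le\omega\|x\|^2$ for all $x\in\mathbb{R}^d$. Algorithm EF21-P + DCGD. Parameters: $\gamma>0$, $x^0\in\mathbb{R}^d$, $w^0=x^0$. For $t=0,1,\dots,T-1$: $g_i^t=\mathcal{C}_i^D(\nabla f_i(w^t))$ for $i=1,\dots,n$; $g^t=\frac1n\sum_ig_i^t$; $x^{t+1}=x^t-\gamma g^t$; $w^{t+1}=w^t+\mathcal{C}^P(x^{t+1}-w^t)$. The random draws of $\mathcal{C}_1^D,\dots,\mathcal{C}_n^D,\mathcal{C}^P$ are mutually independent and fresh (independent of the past) at every iteration. *)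

(* Defs.v *)
From HB Require Import structures.
From mathcomp Require Import all_boot all_order all_algebra finmap.
From mathcomp Require Import all_classical all_reals all_analysis.
Set Implicit Arguments.
Unset Strict Implicit.
Unset Printing Implicit Defensive.
Import Order.TTheory GRing.Theory Num.Theory.
Import numFieldNormedType.Exports.
Local Open Scope classical_set_scope.
Local Open Scope ring_scope.

(* The library norm `|x| on 'rV[R]_d is the sup norm, hence a separate
   definition. The topology, and so [differentiable] and [open], is the same. *)
Definition enorm (R : realType) (d : nat) (x : 'rV[R]_d) : R :=
  Num.sqrt (\sum_(j < d) x 0 j ^+ 2).

Definition grad (R : realType) (d : nat) (f : 'rV[R]_d -> R) (x : 'rV[R]_d) :
    'rV[R]_d :=
  \row_(j < d) 'D_(delta_mx 0 j) f x.

(* The condition 0 <= L follows from the inequality unless d = 0, where without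
   it no smallest constant would exist. *)
Definition smooth (R : realType) (d : nat) (L : R) (f : 'rV[R]_d -> R) : Prop :=
  [/\ 0 <= L, forall x, differentiable f x &
    forall x y, enorm (grad f x - grad f y) <= L * enorm (x - y)].

Definition smoothness_constant (R : realType) (d : nat) (L : R)
    (f : 'rV[R]_d -> R) : Prop :=
  smooth L f /\ forall L', smooth L' f -> L <= L'.

Definition convex_on_space (R : realType) (d : nat) (f : 'rV[R]_d -> R) : Prop :=
  convex_function [set: convex_lmodType 'rV[R]_d] f.

Definition strongly_convex (R : realType) (d : nat) (mu : R)
    (f : 'rV[R]_d -> R) : Prop :=
  forall (x y : 'rV[R]_d) (t : R), 0 <= t <= 1 ->
    f (t *: x + (1 - t) *: y) <=
      t * f x + (1 - t) * f y - mu / 2 * t * (1 - t) * enorm (x - y) ^+ 2.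

Notation borel_rV R d := (g_sigma_algebraType (@open 'rV[R]_d)).

(* A stochastic mapping R^d -> R^d: a random seed s is drawn with distribution
   [law], and x is mapped to [cmap s x]. Joint measurability makes [cmap s x] a
   random vector also when x is itself random; a deterministic mapping is the
   case of a constant dependence on s. *)
Record stoch_map (R : realType) (d : nat) := StochMap {
  seed_display : measure_display;
  seed : measurableType seed_display;
  law : probability seed R;
  cmap : seed -> 'rV[R]_d -> 'rV[R]_d;
  measurable_cmap : measurable_fun [set: seed * borel_rV R d]
    (fun p : seed * borel_rV R d => cmap p.1 p.2 : borel_rV R d) }.

Definition compressor_B (R : realType) (d : nat) (alpha : R)
    (C : stoch_map R d) : Prop :=
  forall x : 'rV[R]_d,
    ('E_(law C)[fun s => (enorm (cmap s x - x) ^+ 2)%R]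
       <= ((1 - alpha) * enorm x ^+ 2)%:E)%E.

(* The mean of a random vector is taken coordinatewise. *)
Definition compressor_U (R : realType) (d : nat) (omega : R)
    (C : stoch_map R d) : Prop :=
  (forall (x : 'rV[R]_d) (j : 'I_d),
    'E_(law C)[fun s => (cmap s x 0 j)%R] = (x 0%R j)%:E)%E /\
  (forall x : 'rV[R]_d,
    ('E_(law C)[fun s => (enorm (cmap s x - x) ^+ 2)%R]
       <= (omega * enorm x ^+ 2)%:E)%E).

Definition mutually_independent (dO : measure_display) (Omega : measurableType dO)
    (R : realType) (P : probability Omega R) (I : choiceType)
    (F : I -> set (set Omega)) : Prop :=
  forall (J : {fset I}) (A : I -> set Omega),
    (forall i, i \in J -> F i (A i)) ->
    P (\bigcap_(i in [set` J]) A i) = (\prod_(i <- J) P (A i))%E.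

(* The events determined by the seed used at iteration [k.1] by the compressor
   [k.2], where [Some i] stands for CD i and [None] for CP. *)
Definition seed_events (R : realType) (d n : nat) (dO : measure_display)
    (Omega : measurableType dO)
    (CD : 'I_n -> stoch_map R d) (CP : stoch_map R d)
    (xiD : forall i : 'I_n, nat -> Omega -> seed (CD i))
    (xiP : nat -> Omega -> seed CP) (k : nat * option 'I_n) :
    set (set Omega) :=
  match k.2 with
  | Some i => preimage_set_system [set: Omega] (xiD i k.1) measurable
  | None => preimage_set_system [set: Omega] (xiP k.1) measurable
  end.

Definition fresh_seeds (R : realType) (d n : nat) (dO : measure_display)
    (Omega : measurableType dO) (P : probability Omega R)
    (CD : 'I_n -> stoch_map R d) (CP : stoch_map R d)
    (xiD : forall i : 'I_n, nat -> {RV P >-> seed (CD i)})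
    (xiP : nat -> {RV P >-> seed CP}) : Prop :=
  [/\ forall i t A, measurable A -> distribution P (xiD i t) A = law (CD i) A,
      forall t A, measurable A -> distribution P (xiP t) A = law CP A &
      mutually_independent P
        (seed_events (fun i t => xiD i t) (fun t => xiP t))].

(* The state is the pair (x^t, w^t). *)
Fixpoint ef21p_dcgd (R : realType) (d n : nat) (Omega : Type)
    (fi : 'I_n -> 'rV[R]_d -> R)
    (CD : 'I_n -> stoch_map R d) (CP : stoch_map R d)
    (xiD : forall i : 'I_n, nat -> Omega -> seed (CD i))
    (xiP : nat -> Omega -> seed CP)
    (gamma : R) (x0 : 'rV[R]_d) (t : nat) (om : Omega) :
    'rV[R]_d * 'rV[R]_d :=
  match t with
  | 0 => (x0, x0)
  | t'.+1 =>
    let: (x, w) := ef21p_dcgd fi xiD xiP gamma x0 t' om in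
    let g := n%:R^-1 *: \sum_(i < n) cmap (xiD i t' om) (grad (fi i) w) in
    let x' := x - gamma *: g in
    (x', w + cmap (xiP t' om) (x' - w))
  end.

Definition frac_pinfty (R : realType) (a b : R) : \bar R :=
  if b == 0 then +oo%E else (a / b)%:E.

(* Main.v *)
(** The potential is [1/(2 gamma) |x^t - xs|^2 + (f x^t - f xs) +
    (4 L / alpha) |w^t - x^t|^2], whose last term vanishes at time 0.  In one
    iteration, the two inner products coming from [|x^{t+1} - xs|^2] and from the
    smoothness of [f] combine so that the terms [|grad f w^t|^2 / 2] cancel up to
    order [gamma^2], the gap [f x^t - f xs] keeps only a small coefficient, and the
    primal compressor contracts [|w - x|^2] enough to absorb the errors.  Its
    expectation is thus multiplied by at most [1 - gamma mu / 2], up to an additive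
    [4 gamma omega H / n] with [H = 1/n \sum_i |grad f_i xs|^2]; summing the
    geometric series gives [8 omega H / (n mu)].

    The conditional expectations of the paper are replaced by Tonelli's theorem:
    for independent X and Y, [E h(X, Y)] is bounded by freezing X and integrating
    over Y first. *)
From HB Require Import structures.
Require Import Defs.
From mathcomp Require Import all_boot all_order all_algebra finmap.
From mathcomp Require Import all_classical all_reals all_analysis.
From mathcomp Require Import measurable_realfun ring lra.
Set Implicit Arguments.
Unset Strict Implicit.
Unset Printing Implicit Defensive.
Import Order.TTheory GRing.Theory Num.Theory.
Import numFieldNormedType.Exports.
Local Open Scope classical_set_scope.
Local Open Scope ring_scope.

(** * Euclidean geometry and smooth convex functions *)

(** The weight [4 L / alpha] is dictated by the contraction that it must leave: Young's inequality
    spends half of the gain [alpha] of the primal compressor on the displacement of [x], and the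
    other half is worth [alpha / 2 * (4 L / alpha) = 2 L] times [|w - x|^2], against errors of
    little more than [L |w - x|^2]. The rate is [gamma mu / 2] and not [gamma mu] because strong
    convexity is used at [w], where the gradients are taken, and
    [|w - xs|^2 >= |x - xs|^2 / 2 - |w - x|^2].

    The obstacle on the probabilistic side is integrability: nothing is known beforehand about the
    moments of the iterates. All integrands along the iteration are therefore kept nonnegative, and
    the noise [U] enters only through shifted squares [|v + U|^2]; this is why the descent
    inequality is completed to a square. Signed integrands occur only for one compressor at a fixed
    point, where its variance bound makes them integrable. *)

Definition dot (R : realType) (d : nat) (x y : 'rV[R]_d) : R :=
  \sum_(j < d) x 0 j * y 0 j.

Section Euclidean.
Variables (R : realType) (d : nat).
Implicit Types x y z v : 'rV[R]_d.

Lemma dotC x y : dot x y = dot y x.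
Proof. by apply: eq_bigr => j _; rewrite mulrC. Qed.

Lemma dotDl x y z : dot (x + y) z = dot x z + dot y z.
Proof. by rewrite -big_split; apply: eq_bigr => j _; rewrite mxE mulrDl. Qed.

Lemma dotZl a x y : dot (a *: x) y = a * dot x y.
Proof. by rewrite mulr_sumr; apply: eq_bigr => j _; rewrite mxE mulrA. Qed.

Lemma dotNl x y : dot (- x) y = - dot x y.
Proof. by rewrite -scaleN1r dotZl mulN1r. Qed.

Lemma dotDr x y z : dot x (y + z) = dot x y + dot x z.
Proof. by rewrite dotC dotDl !(dotC _ x). Qed.

Lemma dotZr a x y : dot x (a *: y) = a * dot x y.
Proof. by rewrite dotC dotZl dotC. Qed.

Lemma dotNr x y : dot x (- y) = - dot x y.
Proof. by rewrite dotC dotNl dotC. Qed.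

Definition dotE := (dotDl, dotDr, dotNl, dotNr, dotZl, dotZr).

Lemma dot0l x : dot 0 x = 0.
Proof. by rewrite -(scale0r 0) dotZl mul0r. Qed.

Lemma dotxx_ge0 x : 0 <= dot x x.
Proof. by apply: sumr_ge0 => j _; rewrite -expr2 sqr_ge0. Qed.

Lemma dotxx_eq0 x : dot x x = 0 -> x = 0.
Proof.
move=> /eqP; rewrite psumr_eq0; last by move=> j _; rewrite -expr2 sqr_ge0.
move=> /allP x0; apply/rowP => j; rewrite mxE; apply/eqP.
by have := x0 j (mem_index_enum j); rewrite -expr2 sqrf_eq0.
Qed.

Lemma enorm_ge0 x : 0 <= enorm x.
Proof. exact: sqrtr_ge0. Qed.

Lemma enorm_sqr x : enorm x ^+ 2 = dot x x.
Proof.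
rewrite sqr_sqrtr; last by apply: sumr_ge0 => j _; rewrite sqr_ge0.
by apply: eq_bigr => j _; rewrite expr2.
Qed.

Lemma dot_le_enormM x y : dot x y <= enorm x * enorm y.
Proof.
have := enorm_sqr x; have := enorm_sqr y.
have := enorm_ge0 x; have := enorm_ge0 y.
move: (enorm x) (enorm y) => a b; rewrite (le_eqVlt 0 b) (le_eqVlt 0 a).
move=> /predU1P[<-|b0] /predU1P[<-|a0] yy xx.
- have -> : y = 0 by apply: dotxx_eq0; rewrite -yy expr0n.
  by rewrite dotC dot0l mulr0.
- have -> : y = 0 by apply: dotxx_eq0; rewrite -yy expr0n.
  by rewrite dotC dot0l mulr0.
- have -> : x = 0 by apply: dotxx_eq0; rewrite -xx expr0n.
  by rewrite dot0l mul0r.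
(* With [a] and [b] the two norms, this square expands to [2 a b (a b - dot x y)]. *)
- have := dotxx_ge0 (b *: x - a *: y).
  rewrite !dotE (dotC y x) -xx -yy => h.
  have: 0 <= a * b * (a * b - dot x y) by nra.
  by rewrite pmulr_rge0 ?mulr_gt0// subr_ge0.
Qed.

Lemma enormZ a x : enorm (a *: x) = `|a| * enorm x.
Proof.
apply/eqP; rewrite -(@eqrXn2 _ 2)// ?mulr_ge0 ?enorm_ge0//.
by rewrite exprMn !enorm_sqr dotZl dotZr mulrA -expr2 real_normK ?num_real.
Qed.

Lemma dotxx_le2 x y : dot x x <= 2 * dot (x - y) (x - y) + 2 * dot y y.
Proof.
have := dotxx_ge0 (x - 2 *: y); rewrite !dotE (dotC y x); nra.
Qed.

End Euclidean.

Section Smooth.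
Variables (R : realType) (d : nat).
Implicit Types (f : 'rV[R]_d -> R) (x y v w : 'rV[R]_d).

Lemma derive_grad f x v : differentiable f x -> 'D_v f x = dot (grad f x) v.
Proof.
move=> df; rewrite (deriveE _ df) {1}(row_sum_delta v).
rewrite linear_sum; apply: eq_bigr => j _.
by rewrite linearZ /= mxE (deriveE _ df) mulrC.
Qed.

Lemma gradN f x : differentiable f x -> grad (fun y => - f y) x = - grad f x.
Proof.
move=> df; apply/rowP => j; rewrite !mxE; apply: (deriveN (f := f)).
exact: diff_derivable.
Qed.

Lemma smoothN L f : smooth L f -> smooth L (fun y => - f y).
Proof.
case=> L0 df lf; split => // [x|x y].
  exact: (differentiableN (df x)).
rewrite !gradN// -opprD -scaleN1r enormZ normrN1 mul1r; exact: lf.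
Qed.

Lemma smooth_grad_le L f x y : smooth L f ->
  dot (grad f x - grad f y) (grad f x - grad f y)
    <= L ^+ 2 * dot (x - y) (x - y).
Proof.
case=> L0 _ lf; rewrite -!enorm_sqr -exprMn lerXn2r// ?nnegrE ?enorm_ge0//.
by rewrite mulr_ge0// enorm_ge0.
Qed.

Lemma is_derive_line f x v t : differentiable f (x + t *: v) ->
  is_derive t (1 : R) (fun s => f (x + s *: v)) (dot (grad f (x + t *: v)) v).
Proof.
move=> df.
have dl : is_diff t (fun s : R => x + s *: v) (fun s : R => s *: v).
  have := is_diffD (is_diff_cst x t) (is_diff_scalel t v).
  by rewrite add0r.
have dfl : differentiable (f \o (fun s : R => x + s *: v)) t.
  by apply: differentiable_comp; first by case: dl.
apply: DeriveDef; first exact: diff_derivable.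
rewrite (deriveE _ dfl) diff_comp; [|by case: dl|exact: df].
have -> := @diff_val _ _ _ _ _ _ _ dl.
by rewrite /= scale1r -derive_grad// deriveE.
Qed.

(** Along the segment, [f] minus its linear part and minus [L / 2 t^2 |v|^2] has a nonpositive
    derivative, by Cauchy-Schwarz and the Lipschitz gradient. Monotonicity between 0 and 1 thus
    replaces an integral of the gradient. *)
Lemma smooth_descent L f x y : smooth L f ->
  f y <= f x + dot (grad f x) (y - x) + L / 2 * dot (y - x) (y - x).
Proof.
move=> [L0 df lf]; set v := y - x.
pose phi t := f (x + t *: v) + (- dot (grad f x) v) * t
   + (- (L / 2 * dot v v)) * t ^+ 2.
have dphi t : is_derive t (1 : R) phi (dot (grad f (x + t *: v)) v
    + (- dot (grad f x) v) + (- (L * dot v v)) * t).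
  have := @is_derive_line f x v t (df _) => d1.
  have -> : phi = (fun s => f (x + s *: v)) + (- dot (grad f x) v) \*: id
      + (- (L / 2 * dot v v)) \*: (id ^+ 2) :> (R -> R).
    by [].
  apply: is_derive_eq.
  by rewrite /= /GRing.scale/= !mulr1 expr1; lra.
have le_phi : forall t, t \in `]0, 1[%R -> derive1 phi t <= 0.
  move=> t; rewrite in_itv /= => /andP[t0 _].
  rewrite derive1E (@derive_val _ _ _ _ _ _ _ (dphi t)).
  have := dot_le_enormM (grad f (x + t *: v) - grad f x) v.
  have := lf (x + t *: v) x.
  rewrite (addrC x) addrK enormZ gtr0_norm// addrC dotDl dotNl -enorm_sqr.
  have := enorm_ge0 v.
  nra.
have : phi 1 <= phi 0.
  apply: (ler0_derive1_le_cc _ le_phi); rewrite ?in_itv/= ?lexx ?ler01//.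
    by apply: derivable_within_continuous => t _; have [] := dphi t.
rewrite /phi scale1r scale0r addr0 /v (addrC x) subrK; lra.
Qed.

Lemma strongly_convex_grad L mu f x y : smooth L f -> strongly_convex mu f ->
  f x + dot (grad f x) (y - x) + mu / 2 * dot (y - x) (y - x) <= f y.
Proof.
move=> sf cf; set v := y - x.
(* The descent lemma for [- f] bounds the difference quotient from below, so that
   the limit t -> 0 becomes an inequality that is affine in t. *)
have key t : 0 < t <= 1 ->
    dot (grad f x) v + mu / 2 * dot v v - (f y - f x)
      <= t * (L / 2 * dot v v + mu / 2 * dot v v).
  move=> /andP[t0 t1].
  have := cf y x t; rewrite (ltW t0) t1 => /(_ isT).
  have [_ df _] := sf.
  have := smooth_descent x (t *: y + (1 - t) *: x) (smoothN sf).
  rewrite gradN//.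
  have -> : t *: y + (1 - t) *: x - x = t *: v.
    by rewrite /v scalerBl scale1r addrA addrAC addrK scalerBr.
  rewrite enorm_sqr !dotE => h1 h2.
  rewrite -(ler_pM2l t0); lra.
set a := _ + _ - _ in key; set b := _ + _ in key.
suff: a <= 0 by rewrite /a; lra.
rewrite leNgt; apply/negP => a0.
(* If [a > 0], some admissible [t] makes [t b] at most [a / 2], against [key]: [1 / 2] when
   [b <= a], and [a / (2 b)] otherwise. *)
have [b0|b0] := leP b a.
  have := key (1 / 2); have -> : (0 < 1 / 2 :> R) && (1 / 2 <= 1 :> R).
    by apply/andP; split; lra.
  by move=> /(_ isT); lra.
have := key (a / (2 * b)).
have bp : 0 < b by lra.
have -> : 0 < a / (2 * b) <= 1.
  by rewrite divr_gt0 ?mulr_gt0//= ler_pdivrMr ?mulr_gt0//; lra.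
move=> /(_ isT).
have -> : a / (2 * b) * b = a / 2 by field; lra.
lra.
Qed.

(** Cocoercivity. The point [x - L^-1 *: q] minimizes the quadratic upper bound at [x] of [f] tilted
    by [- grad f y]. There smoothness at [x] bounds [f] from above and convexity at [y] from
    below. *)
Lemma smooth_convex_grad L f x y : smooth L f -> strongly_convex 0 f ->
  dot (grad f x - grad f y) (grad f x - grad f y)
    <= 2 * L * (f x - f y - dot (grad f y) (x - y)).
Proof.
move=> sf cf; have [L0 _ _] := sf.
have [L00|Ln0] := eqVneq L 0.
  by have := smooth_grad_le x y sf; rewrite L00 expr0n mul0r mulr0 mul0r.
have Lp : 0 < L by rewrite lt_neqAle eq_sym Ln0.
set q := grad f x - grad f y.
have := smooth_descent x (x - L^-1 *: q) sf.
have := strongly_convex_grad y (x - L^-1 *: q) sf cf.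
have -> : x - L^-1 *: q - x = - (L^-1 *: q) by rewrite addrAC subrr sub0r.
have -> : x - L^-1 *: q - y = (x - y) - L^-1 *: q by rewrite addrAC.
have -> : dot q q = dot (grad f x) q - dot (grad f y) q by rewrite -dotNl -dotDl.
rewrite !(dotDr _ (x - y)) !(dotDl (x - y)) !dotNr !dotNl !dotZr !dotZl.
have -> : dot q q = dot (grad f x) q - dot (grad f y) q by rewrite -dotNl -dotDl.
move: (dot (grad f x) q) (dot (grad f y) q) => a b.
move: (dot (grad f y) (x - y)) (f (x - _)) => c z.
have -> : L / 2 * - - (L^-1 * (L^-1 * (a - b))) = L^-1 / 2 * (a - b).
  by field.
rewrite mul0r mul0r addr0 => h1 h2.
have h : L^-1 * (a - b) <= 2 * (f x - f y - c) by lra.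
have := ler_wpM2l (ltW Lp) h; rewrite mulrA divff// mul1r; lra.
Qed.

End Smooth.

(* Here [D = f x - f xs], [F = f w - f xs], [r = |x - xs|^2], [e = |w - x|^2],
   [W = |grad f w|^2], [X = |grad f x|^2], [p], [q] and [s] are the inner products
   of [grad f w] with [x - xs], [grad f x] and [w - x], [u = <grad f x, w - x>],
   [t = <w - x, x - xs>], and [B] bounds the variance of the averaged messages. *)
Lemma one_step_ineq (R : realFieldType)
    (L mu g al ka Lm H D F B r e W X p q s u t : R) :
  0 < L -> 0 < mu -> mu <= L -> 0 < g -> 0 < al -> al <= 1 ->
  0 <= ka -> 0 <= H -> 0 <= B -> g * (100 * L) <= al ->
  g * (160 * ka * Lm) <= 1 ->
  0 <= e -> 0 <= W -> 0 <= X -> 0 <= D -> 0 <= F ->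
  F - p - s + mu / 2 * (r + 2 * t + e) <= 0 ->
  D <= F - s + L / 2 * e ->
  X + W - 2 * q <= L ^+ 2 * e ->
  F <= D + u + L / 2 * e ->
  0 <= X - 2 * L * u + L ^+ 2 * e ->
  X <= 2 * L * D -> W <= 2 * L * F ->
  0 <= r + 4 * t + 4 * e ->
  0 <= al ^+ 2 * e - 4 * al * g * s + 4 * g ^+ 2 * W ->
  B <= ka * (4 * Lm * F + 2 * H) ->
  1 / (2 * g) * (r - 2 * g * p + g ^+ 2 * W + g ^+ 2 * B)
   + (D + L / 2 * (g ^+ 2 * W - 2 * g * L^-1 * q + L^-1 ^+ 2 * X + g ^+ 2 * B)
       - (2 * L)^-1 * X)
   + 4 * L / al * (1 - al) * (e + 2 * g * s + g ^+ 2 * W + g ^+ 2 * B)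
  <= (1 - g * mu / 2) * (1 / (2 * g) * r + D + 4 * L / al * e)
     + 4 * g * ka * H.
Proof.
move=> L0 mu0 muL g0 al0 al1 ka0 H0 B0 gL gk e0 W0 X0 D0 F0 H1 H2 H3 H4 H4' H5 H6
  Ht Hs HB.
(* Strong convexity from [w] to [xs] and descent from [w] to [x] bound [- p], the terms [F] and [s]
   cancelling. [Ht] trades [|w - xs|^2] for [r / 2 - e], which halves [mu] and produces the rate
   [g mu / 2]. *)
have S1 : 1 / (2 * g) * (r - 2 * g * p + g ^+ 2 * W + g ^+ 2 * B) <=
    (1 - g * mu / 2) * (1 / (2 * g) * r) - D + (L / 2 + mu / 2) * e
      + g / 2 * W + g / 2 * B.
  clear - g0 mu0 H1 H2 Ht.
  have -> : 1 / (2 * g) * (r - 2 * g * p + g ^+ 2 * W + g ^+ 2 * B) =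
      1 / (2 * g) * r - p + g / 2 * W + g / 2 * B by field; lra.
  have -> : (1 - g * mu / 2) * (1 / (2 * g) * r) = 1 / (2 * g) * r - mu / 4 * r.
    by field; lra.
  nra.
(* Undoing the completed square leaves [- g q], and [H3] turns it into [- g / 2 W], which cancels
   the term [g / 2 W] of [S1]. *)
have S2 : L / 2 * (g ^+ 2 * W - 2 * g * L^-1 * q + L^-1 ^+ 2 * X + g ^+ 2 * B)
       - (2 * L)^-1 * X <=
    L / 2 * g ^+ 2 * W - g / 2 * W + g / 2 * L ^+ 2 * e + L / 2 * g ^+ 2 * B.
  clear - L0 g0 X0 H3.
  have -> : L / 2 * (g ^+ 2 * W - 2 * g * L^-1 * q + L^-1 ^+ 2 * X + g ^+ 2 * B)
       - (2 * L)^-1 * X = L / 2 * g ^+ 2 * W - g * q + L / 2 * g ^+ 2 * B.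
    by field; lra.
  nra.
pose P := L / al * g.
have P0 : 0 <= P by rewrite mulr_ge0 ?divr_ge0 ?ltW.
have P1 : P <= 1 / 100.
  by rewrite /P mulrAC ler_pdivrMr//; clear - gL; lra.
have c0 : 0 <= 4 * L / al by rewrite !mulr_ge0 ?invr_ge0 ?ltW.
(* Young's inequality with parameter [al / 2] on the cross term [2 g s]; the contraction that
   remains is the term [- 2 L e]. *)
have S3 : 4 * L / al * (1 - al) * (e + 2 * g * s + g ^+ 2 * W + g ^+ 2 * B) <=
    4 * L / al * e - 2 * L * e + 8 * P ^+ 2 / L * W + 4 * P * g * B.
  have gW : 0 <= g ^+ 2 * W by rewrite mulr_ge0// sqr_ge0.
  have gB : 0 <= g ^+ 2 * B by rewrite mulr_ge0// sqr_ge0.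
  clear - al0 al1 L0 c0 Hs e0 gW gB.
  have h : (1 - al) * (e + 2 * g * s + g ^+ 2 * W + g ^+ 2 * B) <=
      (1 - al / 2) * e + (2 / al) * (g ^+ 2 * W) + g ^+ 2 * B.
    have h1 : 2 * g * s <= al / 2 * e + 2 / al * (g ^+ 2 * W).
      rewrite -(ler_pM2l al0) mulrDr.
      have -> : al * (2 / al * (g ^+ 2 * W)) = 2 * (g ^+ 2 * W) by field; lra.
      lra.
    have h2 : (1 - al) * (2 * g * s) <=
        (1 - al) * (al / 2 * e + 2 / al * (g ^+ 2 * W)).
      by rewrite ler_wpM2l//; lra.
    have h3 : (1 - al) * (al / 2 * e + 2 / al * (g ^+ 2 * W)) =
       (1 - al) * (al / 2 * e) + (2 / al * (g ^+ 2 * W)) - 2 * (g ^+ 2 * W).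
      by field; lra.
    have ae : 0 <= al * e by rewrite mulr_ge0// ltW.
    have aae : 0 <= al * (al * e) by rewrite mulr_ge0// ltW.
    have aW : 0 <= al * (g ^+ 2 * W) by rewrite mulr_ge0// ltW.
    have aB : 0 <= al * (g ^+ 2 * B) by rewrite mulr_ge0// ltW.
    lra.
  rewrite -mulrA; apply: (le_trans (ler_wpM2l c0 h)).
  by rewrite le_eqVlt; apply/orP; left; apply/eqP; rewrite /P; field; lra.
have F1 : F <= 2 * D + L * e.
  clear - L0 H4 H4' H5.
  have h : u <= (2 * L)^-1 * X + L / 2 * e.
    rewrite -(ler_pM2l L0) mulrDr.
    have -> : L * ((2 * L)^-1 * X) = X / 2 by field; lra.
    lra.
  have h2 : (2 * L)^-1 * X <= D.
    by rewrite mulrC ler_pdivrMr ?mulr_gt0//; lra.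
  lra.
have gLe : g * L <= 1 / 100 by clear - gL al1; lra.
have gL0 : 0 <= g * L by rewrite mulr_ge0 ?ltW.
have T1 : L / 2 * g ^+ 2 * W <= 1 / 10000 * F.
  have c1 : 0 <= L / 2 * g ^+ 2 by rewrite mulr_ge0 ?sqr_ge0// ltW// divr_gt0.
  apply: (le_trans (ler_wpM2l c1 H6)).
  have -> : L / 2 * g ^+ 2 * (2 * L * F) = (g * L) ^+ 2 * F.
    by clear; field.
  by rewrite ler_wpM2r//; clear - gLe gL0; nra.
have T2 : 8 * P ^+ 2 / L * W <= 16 / 10000 * F.
  have c1 : 0 <= 8 * P ^+ 2 / L.
    by rewrite !mulr_ge0 ?sqr_ge0 ?invr_ge0// ltW.
  apply: (le_trans (ler_wpM2l c1 H6)).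
  have -> : 8 * P ^+ 2 / L * (2 * L * F) = 16 * P ^+ 2 * F.
    by clear - L0; field; lra.
  by rewrite ler_wpM2r//; clear - P0 P1; nra.
have gB0 : 0 <= g * B by exact: mulr_ge0 (ltW g0) B0.
(* [545 / 1000 = 1 / 2 + 1 / 200 + 4 / 100], from [g L <= 1 / 100] and [P <= 1 / 100]. *)
have T3 : g / 2 * B + L / 2 * g ^+ 2 * B + 4 * P * g * B <= 545 / 1000 * (g * B).
  have h1 : P * (g * B) <= 1 / 100 * (g * B) by rewrite ler_wpM2r.
  have h2 : (g * L) * (g * B) <= 1 / 100 * (g * B) by rewrite ler_wpM2r.
  by clear - h1 h2; lra.
have gkH : 0 <= g * ka * H by rewrite !mulr_ge0// ltW.
have T4 : g * B <= F / 40 + 2 * (g * ka * H).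
  apply: (le_trans (ler_wpM2l (ltW g0) HB)).
  have h := ler_wpM2r F0 gk.
  by clear - h; lra.
have T5 : g / 2 * L ^+ 2 * e <= 1 / 200 * (L * e).
  have h : (g * L) * (L * e) <= 1 / 100 * (L * e).
    by rewrite ler_wpM2r// mulr_ge0// ltW.
  by clear - h; lra.
have mue : mu * e <= L * e by rewrite ler_wpM2r.
have Le0 : 0 <= L * e by rewrite mulr_ge0// ltW.
have T6 : g * mu / 2 * (4 * L / al * e) <= 2 / 100 * (L * e).
  have h : P * (mu * e) <= 1 / 100 * (L * e).
    by rewrite ler_pM// mulr_ge0// ltW.
  have -> : g * mu / 2 * (4 * L / al * e) = 2 * (P * (mu * e)).
    by rewrite /P; clear - al0; field; lra.
  by clear - h; lra.
have T7 : g * mu / 2 * D <= 1 / 200 * D.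
  by rewrite ler_wpM2r//; clear - muL gLe g0; nra.
have -> : (1 - g * mu / 2) * (1 / (2 * g) * r + D + 4 * L / al * e) =
  (1 - g * mu / 2) * (1 / (2 * g) * r) + (D - g * mu / 2 * D)
   + (4 * L / al * e - g * mu / 2 * (4 * L / al * e)) by ring.
(* The final balance: [D] needs a coefficient below 0.04 out of 1, [L e] about 1.04 out of 2, and
   [g ka H] 1.09 out of 4. *)
clear - S1 S2 S3 T1 T2 T3 T4 T5 T6 T7 F1 mue Le0 gkH D0.
move: (1 / (2 * g) * _) S1 => a1 S1.
move: (_ * (e + 2 * g * s + _ + _)) S3 => a3 S3.
lra.
Qed.

Section Smooth2.
Variables (R : realType) (d : nat).
Implicit Types (f : 'rV[R]_d -> R) (x y v w : 'rV[R]_d).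

Lemma convex_strongly_convex0 f : convex_on_space f -> strongly_convex 0 f.
Proof.
move=> cf x y t t01; rewrite !mul0r subr0.
have t01' : Itv.spec (Itv.num_sem (R := R)) (Itv.Real `[0%Z, 1%Z]) t.
  by rewrite /Itv.spec /= /Itv.num_sem /= in_itv /= num_real.
have := cf (Itv.mk t01') x y; rewrite !in_setT => /(_ isT isT).
by [].
Qed.

Lemma smooth_continuous L f : smooth L f -> continuous f.
Proof. by case=> _ df _ x; exact/differentiable_continuous. Qed.

(** A gradient step from [xs] would decrease [f] unless the gradient vanishes. The step length
    [1 / (L + 1)] also covers [L = 0]. *)
Lemma grad_min L f xs : smooth L f -> (forall x, f xs <= f x) -> grad f xs = 0.
Proof.
move=> sf fmin; apply: dotxx_eq0; have [L0 _ _] := sf.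
have := le_trans (fmin _) (smooth_descent xs (xs - (L + 1)^-1 *: grad f xs) sf).
rewrite [X in dot _ X](_ : _ = - ((L + 1)^-1 *: grad f xs)); last first.
  by rewrite addrAC subrr sub0r.
rewrite [X in L / 2 * dot X _](_ : _ = - ((L + 1)^-1 *: grad f xs)); last first.
  by rewrite addrAC subrr sub0r.
rewrite !dotE; have := dotxx_ge0 (grad f xs).
move: (dot _ _) => G G0 h; apply/eqP; rewrite eq_le G0 andbT.
have h2 : 0 <= - ((L + 1)^-1 * G) + L / 2 * - - ((L + 1)^-1 * ((L + 1)^-1 * G)).
  lra.
have Lp : 0 < L + 1 by lra.
have := ler_wpM2l (ltW (mulr_gt0 Lp Lp)) h2; rewrite mulr0.
have -> : (L + 1) * (L + 1) * (- ((L + 1)^-1 * G)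
    + L / 2 * - - ((L + 1)^-1 * ((L + 1)^-1 * G))) = - (L + 1) * G + L / 2 * G.
  by field; lra.
nra.
Qed.

Lemma grad_avg n (fi : 'I_n -> 'rV[R]_d -> R) f x :
  (forall x, f x = n%:R^-1 * \sum_(i < n) fi i x) ->
  (forall i x, differentiable (fi i) x) ->
  grad f x = n%:R^-1 *: \sum_(i < n) grad (fi i) x.
Proof.
move=> fE dfi; apply/rowP => j; rewrite !mxE summxE.
have -> : f = n%:R^-1 \*: (\sum_(i < n) fi i).
  by apply/funext => y; rewrite fE /= fct_sumE.
have dfij i : derivable (fi i) x (delta_mx 0 j) by exact: diff_derivable.
rewrite deriveZ; last exact: derivable_sum.
rewrite derive_sum//; congr (_ * _); apply: eq_bigr => i _.
by rewrite mxE.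
Qed.

(** At a unit vector, the quadratic lower and upper bounds of [f] around 0 differ only in [mu / 2]
    and [L / 2]. A unit vector exists only for [0 < d]. *)
Lemma strongly_convex_le_smooth L mu f : (0 < d)%N -> smooth L f ->
  strongly_convex mu f -> mu <= L.
Proof.
move=> d0 sf cf; pose j := Ordinal d0; pose v : 'rV[R]_d := delta_mx 0 j.
have := strongly_convex_grad 0 v sf cf; have := smooth_descent 0 v sf.
have -> : dot (v - 0) (v - 0) = 1.
  rewrite subr0 /dot (bigD1 j)//= big1 ?mxE ?eqxx ?addr0 ?mulr1// => i ij.
  by rewrite mxE (negbTE ij) mul0r.
lra.
Qed.

(** Each of the three squares carries [gamma ^+ 2 * B], the most that centered noise of variance [B]
    in the averaged message adds to it in expectation. The subtracted multiple of [|grad f x|^2] is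
    what completing the square in the descent inequality leaves over. *)
Lemma one_step_bound (L mu gamma alpha kappa Lmax H : R) (f : 'rV[R]_d -> R)
    (xs x w : 'rV[R]_d) (B : R) :
  0 < L -> 0 < mu -> mu <= L -> 0 < gamma -> 0 < alpha -> alpha <= 1 ->
  0 <= kappa -> 0 <= H -> 0 <= B -> gamma * (100 * L) <= alpha ->
  gamma * (160 * kappa * Lmax) <= 1 ->
  smooth L f -> strongly_convex mu f -> grad f xs = 0 ->
  (forall y, f xs <= f y) ->
  B <= kappa * (4 * Lmax * (f w - f xs) + 2 * H) ->
  1 / (2 * gamma) * (dot (x - gamma *: grad f w - xs) (x - gamma *: grad f w - xs)
       + gamma ^+ 2 * B)
   + (f x - f xs + L / 2 * (dot (gamma *: grad f w - L^-1 *: grad f x)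
            (gamma *: grad f w - L^-1 *: grad f x) + gamma ^+ 2 * B)
       - (2 * L)^-1 * dot (grad f x) (grad f x))
   + 4 * L / alpha * (1 - alpha) * (dot (x - gamma *: grad f w - w)
      (x - gamma *: grad f w - w) + gamma ^+ 2 * B)
  <= (1 - gamma * mu / 2) * (1 / (2 * gamma) * dot (x - xs) (x - xs)
       + (f x - f xs) + 4 * L / alpha * dot (w - x) (w - x))
     + 4 * gamma * kappa * H.
Proof.
move=> L0 mu0 muL g0 al0 al1 ka0 H0 B0 gL gk sf cf gxs fmin HB.
have c0 : strongly_convex 0 f.
  move=> y z t t01; apply: (le_trans (cf y z t t01)).
  have /andP[t0 t1] := t01.
  rewrite lerD2l lerN2 !mul0r mulr_ge0 ?sqr_ge0// mulr_ge0 ?subr_ge0//.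
  by rewrite mulr_ge0// divr_ge0// ltW.
have H1 := strongly_convex_grad w xs sf cf.
have H2 := smooth_descent w x sf.
have H3 := smooth_grad_le x w sf.
have H4 := smooth_descent x w sf.
(* [H4'], [Ht] and [Hs] are the instances of Young's inequality that are needed, supplied as
   squares. *)
have H4' := dotxx_ge0 (grad f x - L *: (w - x)).
have H5 := smooth_convex_grad x xs sf c0.
have H6 := smooth_convex_grad w xs sf c0.
have Ht := dotxx_ge0 ((x - xs) + 2 *: (w - x)).
have Hs := dotxx_ge0 (alpha *: (w - x) - (2 * gamma) *: grad f w).
have := @one_step_ineq R L mu gamma alpha kappa Lmax H (f x - f xs) (f w - f xs)
  B (dot (x - xs) (x - xs)) (dot (w - x) (w - x)) (dot (grad f w) (grad f w))
  (dot (grad f x) (grad f x)) (dot (grad f w) (x - xs)) (dot (grad f w) (grad f x))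
  (dot (grad f w) (w - x)) (dot (grad f x) (w - x)) (dot (w - x) (x - xs)).
rewrite gxs !subr0 !dot0l !subr0 in H5 H6.
have [D0 F0] : 0 <= f x - f xs /\ 0 <= f w - f xs by rewrite !subr_ge0.
move: H1 H2 H3 H4 H4' Ht Hs.
rewrite (_ : xs - w = - ((x - xs) + (w - x))); last first.
  by rewrite (addrC (x - xs)) subrKA opprB.
rewrite -(opprB w x).
rewrite (_ : x - gamma *: grad f w - xs = (x - xs) - gamma *: grad f w); last first.
  by rewrite addrAC.
rewrite (_ : x - gamma *: grad f w - w = - ((w - x) + gamma *: grad f w)); last first.
  by rewrite opprD opprB addrAC.
(* All vectors are now combinations of these four, so the expansion leaves only their inner
   products. *)
move: (w - x) (x - xs) (grad f w) (grad f x) H5 H6 => a b gw gx.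
rewrite !dotE (dotC b a) (dotC a gw) (dotC b gw) (dotC a gx) (dotC gx gw).
have := dotxx_ge0 a; have := dotxx_ge0 gw; have := dotxx_ge0 gx.
move: (dot a a) (dot a b) (dot b b) (dot gw gw) (dot gx gx) => aa ab bb WW XX.
move: (dot gw a) (dot gw b) (dot gx a) (dot gw gx) => wa wb xa wx.
clear - L0 mu0 muL g0 al0 al1 ka0 H0 B0 gL gk HB D0 F0.
move=> XX0 WW0 aa0 H5 H6 H1 H2 H3 H4 H4' Ht Hs.
have H5' : XX <= 2 * L * (f x - f xs) by clear - H5; lra.
have H6' : WW <= 2 * L * (f w - f xs) by clear - H6; lra.
move=> hyp; apply: le_trans; last first.
  apply: hyp => //.
  - clear - H1; lra.
  - clear - H2; lra.
  - clear - H3; lra.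
  - clear - H4; lra.
  - clear - H4'; lra.
  - clear - Ht; lra.
  - clear - Hs; lra.
clear; lra.
Qed.

End Smooth2.

(** * Borel measurability of random vectors *)

Section BorelRV.
Variables (R : realType) (d : nat).
Local Notation V := (borel_rV R d).

(** Each member of the union is a rational cube contained in [U], or empty. Keeping the inclusion as
    a condition inside the set makes the index type countable, so that measurability into [borel_rV]
    reduces to coordinates. *)
Lemma open_rV_bigcup_rat (U : set 'rV[R]_d) : open U ->
  U = \bigcup_(p : 'rV[rat]_d * nat)
    [set x | (forall j, `|x 0 j - ratr (p.1 0 j)| < p.2.+1%:R^-1) /\
       (forall y : 'rV[R]_d,
         (forall j, `|y 0 j - ratr (p.1 0 j)| < p.2.+1%:R^-1) -> U y)].
Proof.
move=> oU; apply/seteqP; split => [x Ux|x [p _ [xp]]]; last exact.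
have /nbhs_ballP[e /= e0 xeU] := open_nbhs_nbhs (conj oU Ux).
(* [e / 2] because [x] and any other point of the cube both lie within [k.+1%:R^-1] of its
   centre. *)
have [k ke] : exists k : nat, k.+1%:R^-1 < e / 2.
  have [k _ /(_ k (leqnn k))] := near_infty_natSinv_lt (PosNum (divr_gt0 e0 (ltr0Sn R 1))).
  by exists k.
have k0 : 0 < (k.+1%:R^-1 : R) by rewrite invr_gt0.
have /choice[q qP] j : exists q : rat, `|x 0 j - ratr q| < k.+1%:R^-1.
  have [|q] := @rat_in_itvoo R (x 0 j) (x 0 j + k.+1%:R^-1); first by rewrite ltrDl.
  rewrite in_itv /= => /andP[q1 q2]; exists q.
  by rewrite distrC gtr0_norm ?subr_gt0// ltrBlDl.
exists (\row_j q j, k) => //; split=> [j|y yq]; first by rewrite mxE.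
apply: xeU; split=> // i j; rewrite (ord1 i) /ball /=.
have := yq j; rewrite mxE => yqj.
rewrite -(subrK (ratr (q j)) (x 0 j)) -addrA (le_lt_trans (ler_normD _ _))//.
rewrite (splitr e) ltrD ?(lt_trans _ ke)//.
by rewrite distrC.
Qed.

Lemma measurable_rV dW (W : measurableType dW) (g : W -> 'rV[R]_d) :
  (forall j, measurable_fun setT (fun w => g w 0 j)) ->
  measurable_fun setT (g : W -> V).
Proof.
move=> mg; apply: (@measurability _ _ W V setT g (@open 'rV[R]_d)) => //.
move=> _ [U oU <-]; rewrite setTI (open_rV_bigcup_rat oU) preimage_bigcup.
apply: countable_bigcupT_measurable => //.
move=> [q k] /=.
have [Uq|nUq] := pselect (forall y : 'rV[R]_d,
         (forall j, `|y 0 j - ratr (q 0 j)| < k.+1%:R^-1) -> U y).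
  rewrite (_ : _ @^-1` _ = \bigcap_(j in [set: 'I_d])
      (fun w => g w 0 j) @^-1` ball (ratr (q 0 j) : R) k.+1%:R^-1).
    apply: fin_bigcap_measurable; first exact: finite_finset.
    move=> j _; rewrite -[X in measurable X]setTI.
    by apply: mg => //; exact: measurable_ball.
  apply/seteqP; split => w /=.
    by move=> [wq _] j _; rewrite /ball /= distrC; exact: wq.
  by move=> wq; split => // j; have := wq j I; rewrite /ball /= distrC.
rewrite (_ : _ @^-1` _ = set0)//; apply/seteqP; split => // w [_ /=].
by move/nUq.
Qed.

Lemma continuous_borel_rV (f : 'rV[R]_d -> R) : continuous f ->
  measurable_fun setT (f : V -> R).
Proof.
move=> cf; apply: (measurability _ (RGenOpens.measurableE R)).
move=> _ [_ [a [b ->]] <-]; rewrite setTI; apply: sub_sigma_algebra.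
by move/continuousP : cf; apply; exact: interval_open.
Qed.

Lemma coord_borel_rV j : measurable_fun setT (fun x : V => (x : 'rV[R]_d) 0 j).
Proof. by apply: continuous_borel_rV; exact: coord_continuous. Qed.

End BorelRV.

(** * Independence *)

Section Independence.
Context (dO : measure_display) (Omega : measurableType dO) (R : realType)
  (P : probability Omega R).

(** For fixed [B], both sides are finite measures in [A] that agree on the pi-system [G], hence on
    the sigma-algebra that it generates. *)
Lemma independent_sigma_l (G : set (set Omega)) (B : set Omega) :
  G `<=` measurable -> setI_closed G -> G setT -> measurable B ->
  (forall A, G A -> P (A `&` B) = (P A * P B)%E) ->
  forall A, <<s G >> A -> P (A `&` B) = (P A * P B)%E.
Proof.
move=> Gm GI GT mB GB A sA.
have [r rE] : exists r : {nonneg R}, r%:num%:E = P B.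
  have PB0 : 0 <= fine (P B) by exact: fine_ge0.
  by exists (NngNum PB0); rewrite /= fineK// fin_num_measure.
have rPE C : mscale r P C = (P C * P B)%E by rewrite -rE muleC.
rewrite -rPE; apply: (@g_sigma_algebra_measure_unique _ R Omega G Gm (fun=> setT)
  _ _ (mrestr P mB) (mscale r P)) => //.
- by rewrite bigcup_const.
- by move=> C GC; apply: (etrans (GB C GC)); rewrite -rPE.
- move=> _; apply: (@le_lt_trans _ _ (P B)); last by rewrite ltey_eq fin_num_measure.
  by apply: le_measure; rewrite ?inE //; exact: measurableI.
Qed.

Variables (I : choiceType) (F : I -> set (set Omega)).
Hypothesis F_meas : forall i, F i `<=` measurable.
Hypothesis F_setT : forall i, F i setT.
Hypothesis F_setI : forall i, setI_closed (F i).
Hypothesis F_indep : mutually_independent P F.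

(** The pi-system behind the sigma-algebra of the group [K]. Choosing [a] on all of [I], and not
    only on [J], lets two families be glued by a case distinction. *)
Let cyl (K : set I) : set (set Omega) :=
  [set A | exists (J : {fset I}) (a : I -> set Omega),
    [/\ [set` J] `<=` K, forall i, F i (a i) & A = \bigcap_(i in [set` J]) a i]].

Let cyl_setI K : setI_closed (cyl K).
Proof.
move=> _ _ [J [a [JK Fa ->]]] [J' [b [JK' Fb ->]]].
exists (J `|` J')%fset, (fun i => (if i \in J then a i else setT) `&`
  (if i \in J' then b i else setT)); split.
- by move=> i /=; rewrite in_fsetU => /orP[/JK|/JK'].
- by move=> i; apply: F_setI; case: ifP.
apply/seteqP; split => w /=.
  move=> [wa wb] i _; split; case: ifPn => // ij; [exact: wa|exact: wb].
move=> wab; split=> i /= ij.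
  by have := wab i; rewrite /= in_fsetU ij => /(_ isT)[].
by have := wab i; rewrite /= in_fsetU ij orbT => /(_ isT)[].
Qed.

Let cyl_meas K : cyl K `<=` measurable.
Proof.
move=> _ [J [a [_ Fa ->]]]; apply: fin_bigcap_measurable; first exact: finite_fset.
by move=> i _; exact: F_meas.
Qed.

Let cyl_setT K : cyl K setT.
Proof.
by exists fset0, (fun=> setT); split => //; apply/seteqP; split.
Qed.

Let cyl_sigma K : <<s \bigcup_(i in K) F i >> `<=` <<s cyl K >>.
Proof.
apply: smallest_sub; first exact: smallest_sigma_algebra.
apply: subset_trans (@sub_sigma_algebra _ _ _) => A [i Ki FA].
exists [fset i]%fset, (fun k => if k == i then A else setT); split.
- by move=> k /=; rewrite in_fset1 => /eqP ->.
- by move=> k; case: eqVneq => [->|].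
- apply/seteqP; split => w /=.
    by move=> Aw k /=; rewrite in_fset1 => /eqP ->; rewrite eqxx.
  by move=> /(_ i); rewrite /= in_fset1 eqxx; exact.
Qed.

Let cyl_indep K1 K2 A B : K1 `&` K2 = set0 -> cyl K1 A -> cyl K2 B ->
  P (A `&` B) = (P A * P B)%E.
Proof.
move=> K12 [J [a [JK Fa ->]]] [J' [b [JK' Fb ->]]].
have JJ' i : i \in J -> i \in J' -> False.
  by move=> /JK i1 /JK' i2; have : (K1 `&` K2) i by []; rewrite K12.
pose c i := if i \in J then a i else b i.
have Fc i : F i (c i) by rewrite /c; case: ifP.
have ca i : i \in J -> c i = a i by rewrite /c => ->.
have cb i : i \in J' -> c i = b i.
  by rewrite /c => iJ'; case: ifPn => // /JJ' /(_ iJ').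
have -> : \bigcap_(i in [set` J]) a i `&` \bigcap_(i in [set` J']) b i =
    \bigcap_(i in [set` (J `|` J')%fset]) c i.
  apply/seteqP; split => w /=.
    move=> [wa wb] i /=; rewrite in_fsetU => /orP[] iJ.
      by rewrite ca//; exact: wa.
    by rewrite cb//; exact: wb.
  move=> wc; split=> i /= iJ.
    by rewrite -ca//; apply: wc; rewrite /= in_fsetU iJ.
  by rewrite -cb//; apply: wc; rewrite /= in_fsetU iJ orbT.
rewrite !F_indep//.
have pJ : perm_eq (J `|` J')%fset (J ++ J').
  apply: uniq_perm; rewrite ?fset_uniq//.
    rewrite cat_uniq !fset_uniq andbT/=; apply/hasPn => i iJ'.
    by apply/negP => /JJ' /(_ iJ').
  by move=> i; rewrite in_fsetU mem_cat.
rewrite (perm_big _ pJ) big_cat/=; congr (_ * _)%E; apply: eq_big_seq => i iJ.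
  by rewrite ca.
by rewrite cb.
Qed.

(** Independence passes from cylinders to generated sigma-algebras one factor at a time, the other
    factor being held fixed. *)
Lemma mutually_independent_sigma K1 K2 A B : K1 `&` K2 = set0 ->
  <<s \bigcup_(i in K1) F i >> A -> <<s \bigcup_(i in K2) F i >> B ->
  P (A `&` B) = (P A * P B)%E.
Proof.
move=> K12 /cyl_sigma sA /cyl_sigma sB.
have sm K : <<s cyl K >> `<=` measurable.
  by apply: smallest_sub; [exact: sigma_algebra_measurable|exact: cyl_meas].
have mA := sm _ _ sA.
rewrite setIC muleC; apply: (independent_sigma_l (@cyl_meas K2)) => //.
move=> C cC; rewrite setIC muleC.
apply: (independent_sigma_l (@cyl_meas K1)) => //.
  exact: cyl_meas cC.
by move=> D cD; exact: cyl_indep K12 cD cC.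
Qed.

End Independence.

(** Independence on rectangles makes the law of [(X, Y)] the product of the two laws, by uniqueness
    of product measures; the inner integral of Tonelli's theorem is then the one bounded in the last
    hypothesis. *)
Lemma integral_independent_le (dO d1 d2 : measure_display)
    (Omega : measurableType dO) (T1 : measurableType d1) (T2 : measurableType d2)
    (R : realType) (P : probability Omega R)
    (X : {RV P >-> T1}) (Y : {RV P >-> T2}) (h : T1 * T2 -> \bar R)
    (phi : Omega -> \bar R) :
  (forall A B, measurable A -> measurable B ->
    P (X @^-1` A `&` Y @^-1` B) = (P (X @^-1` A) * P (Y @^-1` B))%E) ->
  measurable_fun setT h -> (forall z, 0 <= h z)%E -> measurable_fun setT phi ->
  (forall w, \int[P]_w' h (X w, Y w') <= phi w)%E ->
  (\int[P]_w h (X w, Y w) <= \int[P]_w phi w)%E.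
Proof.
move=> XY mh h0 mphi hphi.
have mXY : measurable_fun setT (fun w => (X w, Y w)).
  by apply: measurable_fun_pair; exact: measurable_funPT.
pose XY' : {RV P >-> (T1 * T2)%type} := HB.pack (fun w => (X w, Y w))
  (isMeasurableFun.Build _ _ _ _ _ mXY).
have -> : (\int[P]_w h (X w, Y w) = \int[distribution P XY']_z h z)%E.
  by rewrite ge0_integral_distribution.
have -> : (\int[distribution P XY']_z h z =
    \int[distribution P X \x distribution P Y]_z h z)%E.
  apply: eq_measure_integral => A mA _; apply/esym.
  by apply: product_measure_unique => // B C mB mC; rewrite -XY.
have mF := measurable_fun_fubini_tonelli_F (m2 := distribution P Y) _ mh h0.
rewrite fubini_tonelli1// ge0_integral_distribution//=.
  apply: ge0_le_integral => //=.
  - by move=> w _; apply: integral_ge0.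
  - exact: measurableT_comp.
  - move=> w _; apply: le_trans (hphi w).
    by rewrite /fubini_F ge0_integral_distribution//; exact: measurableT_comp.
by move=> x; apply: integral_ge0.
Qed.

(** * Measurability of vector operations, gradients and compressors *)

Section MeasurableVectors.
Context (dW : measure_display) (W : measurableType dW) (R : realType) (d : nat).
Local Notation V := (borel_rV R d).
Implicit Types g h : W -> 'rV[R]_d.

Lemma measurable_fun_sumr (I : Type) (s : seq I) (Q : pred I) (F : I -> W -> R) :
  (forall i, Q i -> measurable_fun setT (F i)) ->
  measurable_fun setT (fun w => \sum_(i <- s | Q i) F i w).
Proof.
move=> mF; elim: s => [|i s IH].
  by under eq_fun do rewrite big_nil; exact: measurable_cst.
have [Qi|/negbTE nQi] := boolP (Q i).
  under eq_fun do rewrite big_cons Qi.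
  by apply: measurable_funD => //; exact: mF.
by under eq_fun do rewrite big_cons nQi.
Qed.

Lemma measurable_coord g j : measurable_fun setT (g : W -> V) ->
  measurable_fun setT (fun w => g w 0 j).
Proof. by move=> mg; exact: (measurableT_comp (coord_borel_rV j) mg). Qed.

Lemma measurable_rVD g h : measurable_fun setT (g : W -> V) ->
  measurable_fun setT (h : W -> V) ->
  measurable_fun setT ((fun w => g w + h w) : W -> V).
Proof.
move=> mg mh; apply: measurable_rV => j; under eq_fun do rewrite mxE.
by apply: measurable_funD; exact: measurable_coord.
Qed.

Lemma measurable_rVZ a g : measurable_fun setT (g : W -> V) ->
  measurable_fun setT ((fun w => a *: g w) : W -> V).
Proof.
move=> mg; apply: measurable_rV => j; under eq_fun do rewrite mxE.
by apply: measurable_funM => //; exact: measurable_coord.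
Qed.

Lemma measurable_rVB g h : measurable_fun setT (g : W -> V) ->
  measurable_fun setT (h : W -> V) ->
  measurable_fun setT ((fun w => g w - h w) : W -> V).
Proof.
move=> mg mh; under eq_fun do rewrite -scaleN1r.
by apply: measurable_rVD => //; exact: measurable_rVZ.
Qed.

Lemma measurable_rV_sum (I : Type) (s : seq I) (Q : pred I)
    (F : I -> W -> 'rV[R]_d) :
  (forall i, Q i -> measurable_fun setT (F i : W -> V)) ->
  measurable_fun setT ((fun w => \sum_(i <- s | Q i) F i w) : W -> V).
Proof.
move=> mF; apply: measurable_rV => j; under eq_fun do rewrite summxE.
by apply: measurable_fun_sumr => i Qi; apply: measurable_coord; exact: mF.
Qed.

Lemma measurable_dot g h : measurable_fun setT (g : W -> V) ->
  measurable_fun setT (h : W -> V) ->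
  measurable_fun setT (fun w => dot (g w) (h w)).
Proof.
move=> mg mh; apply: measurable_fun_sumr => j _.
by apply: measurable_funM; exact: measurable_coord.
Qed.

(** The gradient is continuous: its coordinates move by at most the square root of
    [N y = L^2 |y - x|^2]. As a polynomial in the coordinates, [N] is continuous for the sup-norm
    topology, so the two norms need not be compared. *)
Lemma measurable_grad L f g : smooth L f -> measurable_fun setT (g : W -> V) ->
  measurable_fun setT ((fun w => grad f (g w)) : W -> V).
Proof.
move=> sf mg.
suff mgrad : measurable_fun setT ((fun x : V => grad f x) : V -> V).
  exact: (measurableT_comp mgrad mg).
apply: measurable_rV => j; apply: continuous_borel_rV => x.
have [L0 _ _] := sf.
pose N (y : 'rV[R]_d) := L ^+ 2 * dot (y - x) (y - x).
have cN : {for x, continuous N}.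
  apply: continuousM; first exact: cst_continuous.
  have -> : (fun y => dot (y - x) (y - x)) =
      \sum_(k < d) (fun y : 'rV[R]_d => (y - x) 0 k * (y - x) 0 k).
    by apply/funext => y; rewrite fct_sumE.
  elim/big_ind: _ => [|u v cu cv|k _].
  - exact: cst_continuous.
  - exact: continuousD.
  - have ck : {for x, continuous (fun y : 'rV[R]_d => (y - x) 0 k)}.
      have -> : (fun y : 'rV[R]_d => (y - x) 0 k) = (fun y => y 0 k - x 0 k).
        by apply/funext => y; rewrite !mxE.
      apply: continuousB; last exact: cst_continuous.
      exact: coord_continuous.
    exact: continuousM.
have N0 : N x = 0 by rewrite /N subrr dot0l mulr0.
have FF : Filter (nbhs (x : 'rV[R]_d)) by exact: nbhs_filter.
suff : (fun y => grad f y 0 j) @ nbhs (x : 'rV[R]_d) --> grad f x 0 j by [].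
apply: (proj2 (@cvgrPdist_lt R R _ _ FF _ _)) => e e0.
have cN0 : N @ nbhs (x : 'rV[R]_d) --> (0 : R) by rewrite -N0; exact: cN.
have := (proj1 (@cvgrPdist_lt R R _ _ FF _ _) cN0) (e ^+ 2).
rewrite exprn_gt0// => /(_ isT).
apply: filterS => y; rewrite sub0r normrN => Ny.
rewrite -(@ltr_pXn2r _ 2)// ?nnegrE ?ltW//.
have Ny0 : 0 <= N y by apply: mulr_ge0; [exact: sqr_ge0|exact: dotxx_ge0].
rewrite (ger0_norm Ny0) in Ny; apply: le_lt_trans Ny.
apply: le_trans (smooth_grad_le y x sf).
rewrite distrC real_normK ?num_real// /dot (bigD1 j)//= !mxE -!expr2 lerDl.
by apply: sumr_ge0 => k _; rewrite -expr2 sqr_ge0.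
Qed.

Lemma measurable_cmap_comp (C : stoch_map R d) (xi : W -> seed C) g :
  measurable_fun setT xi -> measurable_fun setT (g : W -> V) ->
  measurable_fun setT ((fun w => cmap (xi w) (g w)) : W -> V).
Proof.
move=> mxi mg.
have mp : measurable_fun setT ((fun w => (xi w, g w)) : W -> (seed C * V)%type).
  exact: measurable_fun_pair.
have := measurableT_comp (@measurable_cmap R d C) mp.
by [].
Qed.

End MeasurableVectors.

(** * Centered noise and its variance *)

Section Noise.
Context (dO : measure_display) (Omega : measurableType dO) (R : realType)
  (P : probability Omega R) (d : nat).
Local Notation V := (borel_rV R d).

(** Measurability relative to [G1] and [G2] lets the independence of two groups of seeds apply to
    any functions of them. *)
Lemma integral_independent_sigma_le (G1 G2 : set (set Omega))
    (d1 d2 : measure_display) (T1 : measurableType d1) (T2 : measurableType d2)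
    (X : Omega -> T1) (Y : Omega -> T2) (h : T1 * T2 -> \bar R)
    (phi : Omega -> \bar R) :
  G1 `<=` measurable -> G2 `<=` measurable ->
  (forall A B, <<s G1 >> A -> <<s G2 >> B -> P (A `&` B) = (P A * P B)%E) ->
  measurable_fun setT (X : g_sigma_algebraType G1 -> T1) ->
  measurable_fun setT (Y : g_sigma_algebraType G2 -> T2) ->
  measurable_fun setT h -> (forall z, 0 <= h z)%E -> measurable_fun setT phi ->
  (forall w, \int[P]_w' h (X w, Y w') <= phi w)%E ->
  (\int[P]_w h (X w, Y w) <= \int[P]_w phi w)%E.
Proof.
move=> mG1 mG2 indep mX mY mh h0 mphi hphi.
have sG G : G `<=` measurable -> <<s G >> `<=` @measurable _ Omega.
  by apply: smallest_sub; exact: sigma_algebra_measurable.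
have mX' : measurable_fun setT X.
  by move=> _ A mA; apply: (sG _ mG1); exact: mX.
have mY' : measurable_fun setT Y.
  by move=> _ A mA; apply: (sG _ mG2); exact: mY.
pose X' : {RV P >-> T1} := HB.pack X (isMeasurableFun.Build _ _ _ _ _ mX').
pose Y' : {RV P >-> T2} := HB.pack Y (isMeasurableFun.Build _ _ _ _ _ mY').
apply: (@integral_independent_le _ _ _ _ _ _ _ P X' Y') => // A B mA mB.
by apply: indep; rewrite -[X in <<s _ >> X]setTI; [exact: mX|exact: mY].
Qed.

(* Satisfied when U is centered with [E |U|^2 <= B]; unlike that formulation, it
   only involves integrals of nonnegative functions, so that sums of independent
   vectors can be handled by Tonelli's theorem. *)
Definition noise_bound (U : Omega -> 'rV[R]_d) (B : R) : Prop :=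
  forall v, (\int[P]_w (dot (v + U w) (v + U w))%:E <= (dot v v + B)%:E)%E.

Lemma noise_boundZ a (U : Omega -> 'rV[R]_d) B : measurable_fun setT (U : Omega -> V) ->
  noise_bound U B -> noise_bound (fun w => a *: U w) (a ^+ 2 * B).
Proof.
move=> mU nU v; have [->|a0] := eqVneq a 0.
  under eq_integral do rewrite scale0r addr0.
  by rewrite integral_cst// [X in (_ * X <= _)%E]probability_setT mule1 expr0n mul0r addr0.
(* For [a != 0] the factor comes out and the shift becomes [a^-1 *: v], which [noise_bound] allows
   since it holds for all shifts. *)
have dE w : (dot (v + a *: U w) (v + a *: U w))%:E =
    ((a ^+ 2)%:E * (dot (a^-1 *: v + U w) (a^-1 *: v + U w))%:E)%E.
  rewrite -EFinM; congr EFin; rewrite -{1 2}(scalerKV a0 v) -scalerDr dotZl dotZr.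
  by rewrite mulrA -expr2.
under eq_integral do rewrite dE.
rewrite ge0_integralZl//.
- apply: le_trans (lee_wpmul2l _ (nU _)) _; first by rewrite lee_fin sqr_ge0.
  rewrite -EFinM lee_fin dotZl dotZr mulrDr !mulrA.
  by rewrite (_ : a ^+ 2 / a / a = 1) ?mul1r//; field.
- apply/measurable_EFinP; apply: measurable_dot; exact: measurable_rVD.
- by move=> w _; rewrite lee_fin dotxx_ge0.
- by rewrite lee_fin sqr_ge0.
Qed.

(** Variances of independent noises add up without any cross term: with [U1] frozen, the bound for
    [U2] is used at the shift [v + U1 w], and then the bound for [U1] at [v]. *)
Lemma noise_boundD (G1 G2 : set (set Omega)) (U1 U2 : Omega -> 'rV[R]_d) B1 B2 :
  G1 `<=` measurable -> G2 `<=` measurable ->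
  (forall A B, <<s G1 >> A -> <<s G2 >> B -> P (A `&` B) = (P A * P B)%E) ->
  measurable_fun setT (U1 : g_sigma_algebraType G1 -> V) ->
  measurable_fun setT (U2 : g_sigma_algebraType G2 -> V) ->
  measurable_fun setT (U1 : Omega -> V) ->
  0 <= B2 ->
  noise_bound U1 B1 -> noise_bound U2 B2 ->
  noise_bound (fun w => U1 w + U2 w) (B1 + B2).
Proof.
move=> mG1 mG2 indep mU1 mU2 mU1' B20 n1 n2 v.
pose h (z : V * V) := (dot (v + ((z.1 : 'rV_d) + (z.2 : 'rV_d)))
  (v + ((z.1 : 'rV_d) + (z.2 : 'rV_d))))%:E.
have mh : measurable_fun setT h.
  apply/measurable_EFinP; apply: measurable_dot; apply: measurable_rVD => //;
    exact: measurable_rVD.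
have mdot : measurable_fun setT (fun w => dot (v + U1 w) (v + U1 w)).
  by apply: measurable_dot; apply: measurable_rVD.
have mphi : measurable_fun setT (fun w => (dot (v + U1 w) (v + U1 w))%:E + B2%:E)%E.
  by apply: emeasurable_funD => //; exact/measurable_EFinP.
have hphi w : (\int[P]_w' h (U1 w, U2 w') <=
    (dot (v + U1 w) (v + U1 w))%:E + B2%:E)%E.
  by rewrite /h/=; under eq_integral do rewrite addrA; rewrite -EFinD; exact: n2.
have h0 z : (0 <= h z)%E by rewrite lee_fin dotxx_ge0.
have := integral_independent_sigma_le mG1 mG2 indep mU1 mU2 mh h0 mphi hphi.
rewrite /h /= => /le_trans; apply.
rewrite ge0_integralD//; last 2 first.
  by move=> w _; rewrite lee_fin dotxx_ge0.
  exact/measurable_EFinP.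
rewrite integral_cst// [X in (_ + _ * X <= _)%E]probability_setT mule1.
by rewrite addrA [leRHS]EFinD leeD2r.
Qed.

End Noise.

Section CompressorNoise.
Context (dO : measure_display) (Omega : measurableType dO) (R : realType)
  (P : probability Omega R) (d : nat).
Local Notation V := (borel_rV R d).

Lemma noise_bound_law (C : stoch_map R d) (xi : {RV P >-> seed C})
    (U : seed C -> 'rV[R]_d) B :
  (forall A, measurable A -> distribution P xi A = law C A) ->
  measurable_fun setT (U : seed C -> V) ->
  noise_bound (law C) U B -> noise_bound P (U \o xi) B.
Proof.
move=> xiC mU nU v; apply: le_trans (nU v).
have -> : (\int[law C]_s (dot (v + U s) (v + U s))%:E =
    \int[distribution P xi]_s (dot (v + U s) (v + U s))%:E)%E.
  by apply: eq_measure_integral => A mA _; first [exact: xiC|exact/esym/xiC].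
rewrite ge0_integral_distribution//.
  by apply/measurable_EFinP; apply: measurable_dot; exact: measurable_rVD.
by move=> s; rewrite lee_fin dotxx_ge0.
Qed.

Lemma integrable_dotxx (U : Omega -> 'rV[R]_d) B :
  measurable_fun setT (U : Omega -> V) ->
  (\int[P]_w (dot (U w) (U w))%:E <= B%:E)%E ->
  P.-integrable setT (fun w => (dot (U w) (U w))%:E).
Proof.
move=> mU UB; apply/integrableP; split.
  by apply/measurable_EFinP; exact: measurable_dot.
under eq_integral do rewrite gee0_abs ?lee_fin ?dotxx_ge0//.
by apply: le_lt_trans UB _; rewrite ltry.
Qed.

Lemma integrable_coord (U : Omega -> 'rV[R]_d) B j :
  measurable_fun setT (U : Omega -> V) ->
  (\int[P]_w (dot (U w) (U w))%:E <= B%:E)%E ->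
  P.-integrable setT (fun w => (U w 0 j)%:E).
Proof.
move=> mU UB; have iU2 := integrable_dotxx mU UB.
have i1 : P.-integrable setT (fun=> 1%:E).
  exact: finite_measure_integrable_cst.
(* Domination by [1 + |U|^2], since [|u| <= 1 + u^2]. *)
apply: le_integrable (integrableD _ (i1) iU2) => //.
  by apply/measurable_EFinP; exact: measurable_coord.
move=> w _ /=; rewrite lee_fin.
have h : U w 0 j ^+ 2 <= dot (U w) (U w).
  rewrite /dot (bigD1 j)//= -expr2 lerDl.
  by apply: sumr_ge0 => k _; rewrite -expr2 sqr_ge0.
rewrite (@ger0_norm _ (_ + _)) ?addr_ge0 ?dotxx_ge0//.
rewrite -real_normK ?num_real// in h.
have := sqr_ge0 (`|U w 0 j| - 1); have := normr_ge0 (U w 0 j).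
by move: `|_| h => u h u0 hu; nra.
Qed.

(** In the expanded square the cross term is linear in [U] and integrates to 0; the second moment
    supplies the integrability that this splitting needs. *)
Lemma centered_noise_bound (U : Omega -> 'rV[R]_d) B :
  measurable_fun setT (U : Omega -> V) ->
  (forall j, \int[P]_w (U w 0 j)%:E = 0)%E ->
  (\int[P]_w (dot (U w) (U w))%:E <= B%:E)%E ->
  noise_bound P U B.
Proof.
move=> mU U0 UB v.
have iU2 := integrable_dotxx mU UB.
have icst c : P.-integrable setT (fun=> c%:E).
  exact: finite_measure_integrable_cst.
have iUj j := integrable_coord j mU UB.
have iVj j : P.-integrable setT (fun w => ((2 * v 0 j)%:E * (U w 0 j)%:E)%E).
  exact: integrableZl.
have dE w : ((dot (v + U w) (v + U w))%:E =
    (dot v v)%:E + (\sum_(j < d) ((2 * v 0 j)%:E * (U w 0 j)%:E))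
      + (dot (U w) (U w))%:E)%E.
  under eq_bigr do rewrite -EFinM.
  rewrite sumEFin -!EFinD; congr EFin.
  have -> : \sum_(j < d) 2 * v 0 j * U w 0 j = 2 * dot v (U w).
    by rewrite mulr_sumr; apply: eq_bigr => j _; rewrite mulrA.
  rewrite !dotE (dotC (U w) v); lra.
under eq_integral do rewrite dE.
rewrite integralD//; last first.
  by apply: integrableD => //; exact: integrable_sum.
rewrite integralD//; last exact: integrable_sum.
rewrite integral_cst// [X in (_ * X + _ + _ <= _)%E]probability_setT mule1.
rewrite integral_sum// big1 ?adde0; last first.
  by move=> j _; rewrite integralZl// U0 mule0.
by rewrite EFinD leeD2l.
Qed.

End CompressorNoise.

Lemma compressor_noise_bound (dO : measure_display) (Omega : measurableType dO)
    (R : realType) (P : probability Omega R) (d : nat) omega (C : stoch_map R d)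
    (xi : {RV P >-> seed C}) a :
  compressor_U omega C ->
  (forall A, measurable A -> distribution P xi A = law C A) ->
  noise_bound P (fun w => cmap (xi w) a - a) (omega * dot a a).
Proof.
move=> [Cmean Cvar] xiC.
have mC : measurable_fun setT ((fun s => cmap s a) : seed C -> borel_rV R d).
  exact: measurable_cmap_comp.
have mU : measurable_fun setT ((fun s => cmap s a - a) : seed C -> borel_rV R d).
  by apply: measurable_rVB => //; exact: measurable_cst.
apply: (noise_bound_law (U := fun s => cmap s a - a) xiC) => //.
have UB : (\int[law C]_s (dot (cmap s a - a) (cmap s a - a))%:E
    <= (omega * dot a a)%:E)%E.
  have := Cvar a; rewrite unlock enorm_sqr.
  by under eq_integral do rewrite enorm_sqr.
apply: centered_noise_bound => // j.
have := Cmean a j; rewrite unlock => Cj.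
have iU := integrable_coord j mU UB.
have ia : (law C).-integrable setT (fun=> (a 0 j)%:E).
  exact: finite_measure_integrable_cst.
have cE s : ((cmap s a 0 j)%:E = ((cmap s a - a) 0 j)%:E + (a 0 j)%:E)%E.
  by rewrite -EFinD !mxE subrK.
have : (\int[law C]_s (((cmap s a - a) 0 j)%:E + (a 0 j)%:E) = (a 0 j)%:E)%E.
  by rewrite -[RHS]Cj; apply: eq_integral => s _; rewrite cE.
rewrite integralD// integral_cst//.
rewrite [X in (_ + _ * X)%E]probability_setT mule1.
by rewrite -[X in _ = X]add0e => /(congr1 (fun z => z - (a 0 j)%:E)%E); rewrite !addeK.
Qed.

Section RealIntegrals.
Context (dO : measure_display) (Omega : measurableType dO) (R : realType)
  (P : probability Omega R).
Implicit Types u v : Omega -> R.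

Lemma ge0_integralD_RV u v :
  measurable_fun setT u -> measurable_fun setT v ->
  (forall w, 0 <= u w) -> (forall w, 0 <= v w) ->
  (\int[P]_w (u w + v w)%:E = \int[P]_w (u w)%:E + \int[P]_w (v w)%:E)%E.
Proof.
move=> mu mv u0 v0; under eq_integral do rewrite EFinD.
by rewrite ge0_integralD//; try (exact/measurable_EFinP);
  move=> w _; rewrite lee_fin.
Qed.

Lemma ge0_integralZl_RV (k : R) u : measurable_fun setT u ->
  (forall w, 0 <= u w) -> 0 <= k ->
  (\int[P]_w (k * u w)%:E = k%:E * \int[P]_w (u w)%:E)%E.
Proof.
move=> mu u0 k0; under eq_integral do rewrite EFinM.
rewrite ge0_integralZl//; first exact/measurable_EFinP.
by move=> w _; rewrite lee_fin.
Qed.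

Lemma integral_probability_cst (k : R) : (\int[P]_w k%:E = k%:E)%E.
Proof. by rewrite integral_cst// [X in (_ * X)%E]probability_setT mule1. Qed.

Lemma ge0_le_integral_RV u v :
  measurable_fun setT u -> measurable_fun setT v ->
  (forall w, 0 <= u w) -> (forall w, u w <= v w) ->
  (\int[P]_w (u w)%:E <= \int[P]_w (v w)%:E)%E.
Proof.
move=> mu mv u0 uv; apply: ge0_le_integral => //; try exact/measurable_EFinP.
  by move=> w _; rewrite lee_fin.
by move=> w _; rewrite lee_fin.
Qed.

Variable d : nat.
Local Notation V := (borel_rV R d).

(** The three squares are those of one uplink step: the distance to [xs], the completed square of
    the descent inequality, and the distance to [w]. *)
Lemma noise_bound_quadratics (U : Omega -> 'rV[R]_d) B a1 a2 a3 k1 k2 k3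
    (v1 v2 v3 : 'rV[R]_d) D :
  measurable_fun setT (U : Omega -> V) -> noise_bound P U B ->
  0 <= k1 -> 0 <= k2 -> 0 <= k3 -> 0 <= D ->
  (\int[P]_w (k1 * dot (v1 + a1 *: U w) (v1 + a1 *: U w)
      + (D + k2 * dot (v2 + a2 *: U w) (v2 + a2 *: U w))
      + k3 * dot (v3 + a3 *: U w) (v3 + a3 *: U w))%:E
   <= (k1 * (dot v1 v1 + a1 ^+ 2 * B) + (D + k2 * (dot v2 v2 + a2 ^+ 2 * B))
      + k3 * (dot v3 v3 + a3 ^+ 2 * B))%:E)%E.
Proof.
move=> mU nU k10 k20 k30 D0.
have mq (v : 'rV[R]_d) a : measurable_fun setT (fun w => dot (v + a *: U w) (v + a *: U w)).
  by apply: measurable_dot; apply: measurable_rVD => //; exact: measurable_rVZ.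
have mkq k (v : 'rV[R]_d) a :
    measurable_fun setT (fun w => k * dot (v + a *: U w) (v + a *: U w)).
  exact: measurable_funM.
have q0 k (v : 'rV[R]_d) a w : 0 <= k -> 0 <= k * dot (v + a *: U w) (v + a *: U w).
  by move=> k0; rewrite mulr_ge0// dotxx_ge0.
have Iq k (v : 'rV[R]_d) a : 0 <= k -> (\int[P]_w (k * dot (v + a *: U w) (v + a *: U w))%:E
    <= (k * (dot v v + a ^+ 2 * B))%:E)%E.
  move=> k0; rewrite ge0_integralZl_RV//; last by move=> w; exact: dotxx_ge0.
  by rewrite EFinM lee_wpmul2l ?lee_fin//; exact: noise_boundZ.
have m2 : measurable_fun setT
    (fun w => D + k2 * dot (v2 + a2 *: U w) (v2 + a2 *: U w)).
  exact: measurable_funD.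
have p2 w : 0 <= D + k2 * dot (v2 + a2 *: U w) (v2 + a2 *: U w).
  by rewrite addr_ge0// q0.
have p1 w := q0 k1 v1 a1 w k10.
have p12 w := addr_ge0 (p1 w) (p2 w).
rewrite (ge0_integralD_RV (measurable_funD (mkq k1 v1 a1) m2) (mkq k3 v3 a3) p12
  (fun w => q0 k3 v3 a3 w k30)).
rewrite (ge0_integralD_RV (mkq k1 v1 a1) m2 p1 p2).
rewrite (ge0_integralD_RV (measurable_cst D) (mkq k2 v2 a2) (fun=> D0)
  (fun w => q0 k2 v2 a2 w k20)).
by rewrite integral_probability_cst !EFinD !leeD//; exact: Iq.
Qed.

End RealIntegrals.

Lemma le_frac_pinfty (R : realType) (g a b : R) : 0 <= a -> 0 <= b ->
  (g%:E <= frac_pinfty a b)%E -> g * b <= a.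
Proof.
rewrite /frac_pinfty; case: eqVneq => [-> a0 _ _|b0 _ bge0].
  by rewrite mulr0.
by rewrite lee_fin ler_pdivlMr// lt_neqAle eq_sym b0.
Qed.

(** Splitting off [grad (fi i) xs] costs a factor 2, and cocoercivity bounds the rest by a Bregman
    divergence of [fi i]. On average the linear parts of these divergences cancel, because the
    gradients at [xs] sum to 0. *)
Lemma avg_grad_bound (R : realType) (d n : nat) (fi : 'I_n -> 'rV[R]_d -> R)
    (f : 'rV[R]_d -> R) (Li : 'I_n -> R) (Lmax omega : R) (xs w : 'rV[R]_d) :
  (0 < n)%N -> (forall x, f x = n%:R^-1 * \sum_(i < n) fi i x) ->
  (forall i, smooth (Li i) (fi i)) -> (forall i, Li i <= Lmax) ->
  (forall i, strongly_convex 0 (fi i)) -> grad f xs = 0 -> 0 <= omega ->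
  n%:R^-1 ^+ 2 * (\sum_(i < n) omega * dot (grad (fi i) w) (grad (fi i) w)) <=
  omega / n%:R * (4 * Lmax * (f w - f xs)
     + 2 * (n%:R^-1 * \sum_(i < n) enorm (grad (fi i) xs) ^+ 2)).
Proof.
move=> n0 fE sfi LiL cfi gxs om0.
have np : 0 < n%:R :> R by rewrite ltr0n.
have term i : dot (grad (fi i) w) (grad (fi i) w) <=
    4 * Lmax * (fi i w - fi i xs - dot (grad (fi i) xs) (w - xs))
      + 2 * enorm (grad (fi i) xs) ^+ 2.
  apply: le_trans (dotxx_le2 _ (grad (fi i) xs)) _.
  rewrite enorm_sqr lerD2r.
  have h1 := smooth_convex_grad w xs (sfi i) (cfi i).
  have h2 := strongly_convex_grad xs w (sfi i) (cfi i).
  (* A nonnegative Bregman divergence allows [Li i] to be replaced by [Lmax]. *)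
  have h3 : 0 <= fi i w - fi i xs - dot (grad (fi i) xs) (w - xs).
    by rewrite mul0r mul0r addr0 in h2; clear - h2; lra.
  have := ler_wpM2r h3 (LiL i); move: h1; clear.
  move: (_ - dot (grad (fi i) xs) _) => b; move: (dot _ _) => a; lra.
have sum0 : \sum_(i < n) dot (grad (fi i) xs) (w - xs) = 0.
  have dotsum (s : seq 'I_n) :
      \sum_(i <- s) dot (grad (fi i) xs) (w - xs) =
      dot (\sum_(i <- s) grad (fi i) xs) (w - xs).
    elim: s => [|i s IH]; first by rewrite !big_nil dot0l.
    by rewrite !big_cons dotDl IH.
  have gavg := grad_avg (fi := fi) xs fE (fun i => let: And3 _ h _ := sfi i in h).
  rewrite dotsum -[\sum_(i < n) _](scalerKV (lt0r_neq0 np)).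
  by rewrite -gavg gxs scaler0 dot0l.
have : \sum_(i < n) dot (grad (fi i) w) (grad (fi i) w) <=
    n%:R * (4 * Lmax * (f w - f xs)
      + 2 * (n%:R^-1 * \sum_(i < n) enorm (grad (fi i) xs) ^+ 2)).
  apply: le_trans (ler_sum _ (fun i _ => term i)) _.
  rewrite big_split /= -!mulr_sumr !sumrB sum0 subr0 !fE.
  move: (\sum_(i < n) _) (\sum_(i < n) _) (\sum_(i < n) _) => a b c.
  by rewrite le_eqVlt; apply/orP; left; apply/eqP; field; exact: lt0r_neq0.
rewrite -mulr_sumr; move: (\sum_(i < n) dot _ _) => S; move: (_ + 2 * _) => Q h.
have -> : n%:R^-1 ^+ 2 * (omega * S) = omega / n%:R * (n%:R^-1 * S).
  by field; exact: lt0r_neq0.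
apply: ler_wpM2l; first by rewrite divr_ge0// ltW.
by rewrite mulrC ler_pdivrMr// mulrC.
Qed.

(** * The iterates *)

Definition dcgd_step (R : realType) (d n : nat) (fi : 'I_n -> 'rV[R]_d -> R)
    (CD : 'I_n -> stoch_map R d) (gamma : R) (s : forall i, seed (CD i))
    (x w : 'rV[R]_d) : 'rV[R]_d :=
  x - gamma *: (n%:R^-1 *: \sum_(i < n) cmap (s i) (grad (fi i) w)).

Lemma ef21p_dcgdS (R : realType) (d n : nat) (Omega : Type)
    (fi : 'I_n -> 'rV[R]_d -> R) (CD : 'I_n -> stoch_map R d) (CP : stoch_map R d)
    (xiD : forall i : 'I_n, nat -> Omega -> seed (CD i))
    (xiP : nat -> Omega -> seed CP) (gamma : R) (x0 : 'rV[R]_d) (t : nat) om :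
  let: z := ef21p_dcgd fi xiD xiP gamma x0 t om in
  let: x' := dcgd_step fi gamma (fun i => xiD i t om) z.1 z.2 in
  ef21p_dcgd fi xiD xiP gamma x0 t.+1 om =
    (x', z.2 + cmap (xiP t om) (x' - z.2)).
Proof. by rewrite /= /dcgd_step; case: (ef21p_dcgd _ _ _ _ _ _ _). Qed.

Section MeasurableState.
Context (R : realType) (d n : nat) (fi : 'I_n -> 'rV[R]_d -> R)
  (Li : 'I_n -> R) (fi_smooth : forall i, smooth (Li i) (fi i))
  (CD : 'I_n -> stoch_map R d) (CP : stoch_map R d) (gamma : R) (x0 : 'rV[R]_d).
Local Notation V := (borel_rV R d).

Lemma measurable_dcgd_step (dW : measure_display) (W : measurableType dW)
    (y : forall i : 'I_n, W -> seed (CD i)) (x w : W -> 'rV[R]_d) :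
  (forall i, measurable_fun setT (y i)) ->
  measurable_fun setT (x : W -> V) -> measurable_fun setT (w : W -> V) ->
  measurable_fun setT
    ((fun om => dcgd_step fi gamma (fun i => y i om) (x om) (w om)) : W -> V).
Proof.
move=> my mx mw; apply: measurable_rVB => //; apply: measurable_rVZ.
apply: measurable_rVZ; apply: measurable_rV_sum => i _.
by apply: measurable_cmap_comp => //; exact: measurable_grad (fi_smooth i) mw.
Qed.

(** The space [W] is arbitrary and only the seeds before [t] matter, so that the result serves both
    for [Omega] and for the sigma-algebra of the past. *)
Lemma measurable_ef21p_dcgd (dW : measure_display) (W : measurableType dW)
    (yD : forall i : 'I_n, nat -> W -> seed (CD i)) (yP : nat -> W -> seed CP)
    (t : nat) :
  (forall i s, (s < t)%N -> measurable_fun setT (yD i s)) ->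
  (forall s, (s < t)%N -> measurable_fun setT (yP s)) ->
  measurable_fun setT ((fun om => (ef21p_dcgd fi yD yP gamma x0 t om).1) : W -> V) /\
  measurable_fun setT ((fun om => (ef21p_dcgd fi yD yP gamma x0 t om).2) : W -> V).
Proof.
elim: t => [|t IH] mD mP; first by split; exact: measurable_cst.
have [||mx mw] := IH.
- by move=> i s st; apply: mD; exact: ltnW.
- by move=> s st; apply: mP; exact: ltnW.
have mx' := measurable_dcgd_step (fun i => mD i t (ltnSn t)) mx mw.
split.
  by under eq_fun do rewrite ef21p_dcgdS.
under eq_fun do rewrite ef21p_dcgdS.
apply: measurable_rVD => //; apply: measurable_cmap_comp; first exact: mP.
exact: measurable_rVB.
Qed.

End MeasurableState.

(** * Sigma-algebras generated by groups of seeds *)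

Section Seeds.
Context (R : realType) (d n : nat) (dO : measure_display)
  (Omega : measurableType dO) (P : probability Omega R)
  (CD : 'I_n -> stoch_map R d) (CP : stoch_map R d)
  (xiD : forall i : 'I_n, nat -> {RV P >-> seed (CD i)})
  (xiP : nat -> {RV P >-> seed CP}) (xi_fresh : fresh_seeds xiD xiP).
Local Notation V := (borel_rV R d).

(** Only a generating family: the sigma-algebra is formed by [<<s _ >>] or [g_sigma_algebraType]. *)
Definition seed_sigma (K : set (nat * option 'I_n)) : set (set Omega) :=
  \bigcup_(k in K) seed_events (fun i s => xiD i s) (fun s => xiP s) k.

Lemma seed_events_measurable k :
  seed_events (fun i s => xiD i s) (fun s => xiP s) k `<=` @measurable _ Omega.
Proof.
rewrite /seed_events; case: k.2 => [i|] _ [A mA <-].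
  by apply: measurable_funPT.
by apply: measurable_funPT.
Qed.

Lemma seed_sigma_measurable K : seed_sigma K `<=` measurable.
Proof. by move=> A [k _]; exact: seed_events_measurable. Qed.

Lemma seed_sigma_independent K1 K2 A B : K1 `&` K2 = set0 ->
  <<s seed_sigma K1 >> A -> <<s seed_sigma K2 >> B ->
  P (A `&` B) = (P A * P B)%E.
Proof.
have [_ _ indep] := xi_fresh.
apply: (mutually_independent_sigma seed_events_measurable _ _ indep).
  move=> k; rewrite /seed_events; case: k.2 => [i|];
    by exists setT; rewrite ?preimage_setT ?setTI.
move=> k A' B'; rewrite /seed_events; case: k.2 => [i|] [A1 mA1 <-] [B1 mB1 <-];
  by exists (A1 `&` B1); [exact: measurableI|rewrite preimage_setI setIIr].
Qed.

Lemma measurable_xiD (K : set (nat * option 'I_n)) i t : K (t, Some i) ->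
  measurable_fun setT (xiD i t : g_sigma_algebraType (seed_sigma K) -> seed (CD i)).
Proof.
move=> Kt _ A mA; apply: sub_sigma_algebra; exists (t, Some i) => //.
by exists A.
Qed.

Lemma measurable_xiP (K : set (nat * option 'I_n)) t : K (t, None) ->
  measurable_fun setT (xiP t : g_sigma_algebraType (seed_sigma K) -> seed CP).
Proof.
move=> Kt _ A mA; apply: sub_sigma_algebra; exists (t, None) => //.
by exists A.
Qed.

(** Induction on [s] through [noise_boundD]; [uniq s] keeps the seed of the head out of the group of
    the tail. *)
Lemma noise_bound_sum omega (a : 'I_n -> 'rV[R]_d) t (s : seq 'I_n) :
  (forall i, compressor_U omega (CD i)) -> 0 <= omega -> uniq s ->
  noise_bound P (fun w => \sum_(i <- s) (cmap (xiD i t w) (a i) - a i))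
    (\sum_(i <- s) omega * dot (a i) (a i)).
Proof.
move=> CU om0; have [lawD _ _] := xi_fresh.
elim: s => [_ v|i s IH /andP[iNs us]].
  under eq_integral do rewrite big_nil addr0.
  by rewrite big_nil addr0 integral_probability_cst.
pose K1 := [set k : nat * option 'I_n | k = (t, Some i)].
pose K2 := [set k : nat * option 'I_n | exists2 j, j \in s & k = (t, Some j)].
have mU (K : set (nat * option 'I_n)) j : K (t, Some j) -> measurable_fun setT
    ((fun w => cmap (xiD j t w) (a j) - a j) : g_sigma_algebraType (seed_sigma K) -> V).
  move=> Kj; apply: measurable_rVB => //; apply: measurable_cmap_comp => //.
  exact: measurable_xiD.
have -> : (fun w => \sum_(j <- i :: s) (cmap (xiD j t w) (a j) - a j)) =
    (fun w => (cmap (xiD i t w) (a i) - a i) +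
       \sum_(j <- s) (cmap (xiD j t w) (a j) - a j)).
  by apply/funext => w; rewrite big_cons.
rewrite big_cons.
apply: (@noise_boundD _ _ _ _ _ (seed_sigma K1) (seed_sigma K2)).
- exact: seed_sigma_measurable.
- exact: seed_sigma_measurable.
- move=> A B; apply: seed_sigma_independent.
  apply/seteqP; split => // k [-> [j js [ij]]].
  by rewrite ij js in iNs.
- exact: mU.
- under eq_fun do rewrite big_seq.
  by apply: measurable_rV_sum => j js; apply: mU; exists j.
- apply: measurable_rVB => //; apply: measurable_cmap_comp => //.
- by apply: sumr_ge0 => j _; rewrite mulr_ge0// dotxx_ge0.
- by apply: compressor_noise_bound => // A mA; exact: lawD.
- exact: IH.
Qed.

End Seeds.

(** * Decrease of the potential *)

(** The weight [c] and the error [e] are left free: between iterations they are [4 L / alpha] and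
    [w - x]; between uplink and downlink the weight is damped by [1 - alpha] and the error is the
    vector about to be compressed. *)
Definition potential (R : realType) (d : nat) (f : 'rV[R]_d -> R) (xs : 'rV[R]_d)
    (gamma c : R) (x e : 'rV[R]_d) : R :=
  1 / (2 * gamma) * dot (x - xs) (x - xs) + (f x - f xs) + c * dot e e.

(** The identity behind it is [L / 2 |g y|^2 - g p = L / 2 |g y - L^-1 a|^2 - (2 L)^-1 |a|^2], with
    [a] the gradient at [x] and [p] its inner product with [y]. The bracketing is the one that
    [dotE] produces. *)
Lemma descent_complete_square (R : realFieldType) (L g p q r z1 z2 z3 A C : R) :
  L != 0 -> z1 <= z2 - g * p + L / 2 * - (g * - (g * q)) ->
  A + (z1 - z3) + C + (2 * L)^-1 * r <=
  A + (z2 - z3 + L / 2 * (g * (g * q - L^-1 * p)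
     + (g * - (L^-1 * p) - - (L^-1 * (L^-1 * r))))) + C.
Proof.
move=> L0.
have -> : L / 2 * (g * (g * q - L^-1 * p)
     + (g * - (L^-1 * p) - - (L^-1 * (L^-1 * r)))) =
     L / 2 * (g * (g * q)) - g * p + (2 * L)^-1 * r by field.
lra.
Qed.

(* The descent lemma enters as a completed square, so that [noise_bound] applies. *)
Lemma potential_step_le (R : realType) (d : nat) (f : 'rV[R]_d -> R)
    (xs : 'rV[R]_d) L gamma k (x w v u : 'rV[R]_d) :
  0 < L -> smooth L f ->
  potential f xs gamma k (x - gamma *: (v + u)) (x - gamma *: (v + u) - w)
    + (2 * L)^-1 * dot (grad f x) (grad f x) <=
  1 / (2 * gamma) * dot (x - gamma *: v - xs + - gamma *: u)
      (x - gamma *: v - xs + - gamma *: u)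
   + (f x - f xs + L / 2 * dot (gamma *: v - L^-1 *: grad f x + gamma *: u)
       (gamma *: v - L^-1 *: grad f x + gamma *: u))
   + k * dot (x - gamma *: v - w + - gamma *: u) (x - gamma *: v - w + - gamma *: u).
Proof.
move=> L0 sf; have := smooth_descent x (x - gamma *: (v + u)) sf.
rewrite /potential; move: (grad f x) => gx.
have e1 z : x - gamma *: (v + u) - z = x - gamma *: v - z + - gamma *: u.
  by rewrite scalerDr opprD addrA scaleNr [LHS]addrAC.
rewrite (e1 xs) (e1 w).
have -> : gamma *: v - L^-1 *: gx + gamma *: u =
    gamma *: (v + u) - L^-1 *: gx by rewrite scalerDr addrAC.
have -> : x - gamma *: (v + u) - x = - (gamma *: (v + u)).
  by rewrite addrAC subrr sub0r.
move: (v + u) (x - gamma *: v - xs + _) (x - gamma *: v - w + _) => y A1 A2.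
rewrite !dotE (dotC y gx); exact: descent_complete_square (lt0r_neq0 L0).
Qed.

Section OneStep.
Context (R : realType) (d n : nat) (n_gt0 : (0 < n)%N)
  (fi : 'I_n -> 'rV[R]_d -> R) (f : 'rV[R]_d -> R)
  (f_def : forall x, f x = n%:R^-1 * \sum_(i < n) fi i x)
  (L : R) (f_smooth : smooth L f)
  (Li : 'I_n -> R) (fi_smooth : forall i, smooth (Li i) (fi i))
  (Lmax : R) (Li_le : forall i, Li i <= Lmax)
  (fi_convex : forall i, strongly_convex 0 (fi i))
  (mu : R) (mu_gt0 : 0 < mu) (f_strongly_convex : strongly_convex mu f)
  (xs : 'rV[R]_d) (xs_min : forall x, f xs <= f x)
  (omega : R) (omega_ge0 : 0 <= omega)
  (CD : 'I_n -> stoch_map R d) (CD_U : forall i, compressor_U omega (CD i))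
  (alpha : R) (alpha_gt0 : 0 < alpha) (alpha_le1 : alpha <= 1)
  (CP : stoch_map R d) (CP_B : compressor_B alpha CP)
  (dO : measure_display) (Omega : measurableType dO) (P : probability Omega R)
  (xiD : forall i : 'I_n, nat -> {RV P >-> seed (CD i)})
  (xiP : nat -> {RV P >-> seed CP})
  (xi_fresh : fresh_seeds xiD xiP)
  (gamma : R) (gamma_gt0 : 0 < gamma) (L_gt0 : 0 < L) (mu_le : mu <= L)
  (gamma_le1 : gamma * (160 * omega * Lmax) <= n%:R)
  (gamma_le2 : gamma * (100 * L) <= alpha).
Local Notation V := (borel_rV R d).
Local Notation c := (4 * L / alpha).
Local Notation H := (n%:R^-1 * \sum_(i < n) enorm (grad (fi i) xs) ^+ 2).
Local Notation pot := (potential f xs gamma).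

Lemma weight_ge0 : 0 <= c.
Proof. by rewrite !mulr_ge0 ?invr_ge0// ltW. Qed.

Lemma damped_weight_ge0 : 0 <= c * (1 - alpha).
Proof. by rewrite mulr_ge0 ?weight_ge0// subr_ge0. Qed.

Lemma potential_ge0 k x e : 0 <= k -> 0 <= pot k x e.
Proof.
move=> k0; have g0 : 0 <= 1 / (2 * gamma) by rewrite divr_ge0// mulr_ge0// ltW.
have D0 : 0 <= f x - f xs by rewrite subr_ge0.
apply: addr_ge0; last exact: mulr_ge0 (dotxx_ge0 _).
by apply: addr_ge0 => //; exact: mulr_ge0 (dotxx_ge0 _).
Qed.

Lemma measurable_potential k (dW : measure_display) (W : measurableType dW)
    (x e : W -> 'rV[R]_d) :
  measurable_fun setT (x : W -> V) -> measurable_fun setT (e : W -> V) ->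
  measurable_fun setT (fun w => pot k (x w) (e w)).
Proof.
move=> mx me.
have mf : measurable_fun setT (fun w => f (x w)).
  exact: (measurableT_comp (continuous_borel_rV (smooth_continuous f_smooth)) mx).
have mxs : measurable_fun setT ((fun w => x w - xs) : W -> V).
  by apply: measurable_rVB => //; exact: measurable_cst.
apply: measurable_funD; last first.
  by apply: measurable_funM => //; exact: measurable_dot.
apply: measurable_funD; last exact: measurable_funB.
by apply: measurable_funM => //; exact: measurable_dot.
Qed.

Lemma downlink_bound t (x w : 'rV[R]_d) :
  (\int[P]_om (pot c x (w + cmap (xiP t om) (x - w) - x))%:E <=
     (pot (c * (1 - alpha)) x (x - w))%:E)%E.
Proof.
have [_ lawP _] := xi_fresh.
set y := x - w.
have mC : measurable_fun setT ((fun s => cmap s y - y) : seed CP -> V).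
  by apply: measurable_rVB; [exact: measurable_cmap_comp|exact: measurable_cst].
have mdC := measurable_dot mC mC.
have mdxi : measurable_fun setT
    (fun om => dot (cmap (xiP t om) y - y) (cmap (xiP t om) y - y)).
  exact: (measurableT_comp mdC (measurable_funPT (xiP t))).
have Ce : (\int[P]_om (dot (cmap (xiP t om) y - y) (cmap (xiP t om) y - y))%:E <=
    ((1 - alpha) * dot y y)%:E)%E.
  have := CP_B y; rewrite unlock enorm_sqr; apply: le_trans.
  have -> : (\int[law CP]_s (enorm (cmap s y - y) ^+ 2)%:E =
      \int[distribution P (xiP t)]_s (dot (cmap s y - y) (cmap s y - y))%:E)%E.
    under eq_integral do rewrite enorm_sqr.
    by apply: eq_measure_integral => A mA _; first [exact: lawP|exact/esym/lawP].
  rewrite ge0_integral_distribution//; first exact/measurable_EFinP.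
  by move=> s; rewrite lee_fin dotxx_ge0.
(* The new error is the compression error of [y] itself, so the contraction property applies
   verbatim. *)
have eE om : w + cmap (xiP t om) y - x = cmap (xiP t om) y - y.
  by rewrite /y opprB addrCA addrA.
under eq_integral do rewrite eE.
have p0 : 0 <= pot 0 x 0 by exact: potential_ge0.
have pE k e : pot k x e = pot 0 x 0 + k * dot e e.
  by rewrite /potential mul0r addr0.
under eq_integral do rewrite pE.
rewrite ge0_integralD_RV//.
- rewrite integral_probability_cst ge0_integralZl_RV// ?weight_ge0//; last first.
    by move=> om; exact: dotxx_ge0.
  rewrite [in leRHS]pE [leRHS]EFinD leeD2l//.
  have -> : (c * (1 - alpha) * dot y y)%:E = (c%:E * ((1 - alpha) * dot y y)%:E)%E.
    by rewrite -EFinM mulrA.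
  by apply: lee_wpmul2l => //; rewrite lee_fin weight_ge0.
- exact: measurable_funM.
- by move=> om; rewrite mulr_ge0 ?weight_ge0 ?dotxx_ge0.
Qed.

Lemma uplink_bound t (x w : 'rV[R]_d) :
  (\int[P]_om (let x' := dcgd_step fi gamma (fun i => xiD i t om) x w in
       pot (c * (1 - alpha)) x' (x' - w))%:E <=
     ((1 - gamma * mu / 2) * pot c x (w - x) + 4 * gamma * (omega / n%:R) * H)%:E)%E.
Proof.
have np : 0 < n%:R :> R by rewrite ltr0n.
pose a i := grad (fi i) w.
pose U om := n%:R^-1 *: \sum_(i < n) (cmap (xiD i t om) (a i) - a i).
pose B := n%:R^-1 ^+ 2 * \sum_(i < n) omega * dot (a i) (a i).
have mxi i : measurable_fun setT
    ((fun om => cmap (xiD i t om) (a i) - a i) : Omega -> V).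
  by apply: measurable_rVB; [exact: measurable_cmap_comp|exact: measurable_cst].
have mU : measurable_fun setT (U : Omega -> V).
  by apply: measurable_rVZ; exact: measurable_rV_sum.
have nU : noise_bound P U B.
  apply: noise_boundZ; first exact: measurable_rV_sum.
  by apply: (noise_bound_sum xi_fresh _ _ CD_U omega_ge0); exact: index_enum_uniq.
have gxs := grad_min f_smooth xs_min.
have B0 : 0 <= B.
  rewrite mulr_ge0 ?sqr_ge0// sumr_ge0// => i _.
  by rewrite mulr_ge0// dotxx_ge0.
have BB := avg_grad_bound w n_gt0 f_def fi_smooth Li_le fi_convex gxs omega_ge0.
have H0 : 0 <= H.
  by rewrite mulr_ge0 ?invr_ge0 ?ler0n// sumr_ge0// => i _; exact: sqr_ge0.
have gk : gamma * (160 * (omega / n%:R) * Lmax) <= 1.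
  rewrite [leLHS](_ : _ = gamma * (160 * omega * Lmax) / n%:R); last first.
    by field; exact: lt0r_neq0.
  by rewrite ler_pdivrMr// mul1r.
have := one_step_bound (kappa := omega / n%:R) (H := H) (B := B) x (w := w) L_gt0
  mu_gt0 mu_le gamma_gt0 alpha_gt0 alpha_le1 (divr_ge0 omega_ge0 (ltW np)) H0 B0
  gamma_le2 gk f_smooth f_strongly_convex gxs xs_min BB.
set gw := grad f w; set gx := grad f x => main.
have stepE om : dcgd_step fi gamma (fun i => xiD i t om) x w =
    x - gamma *: (gw + U om).
  rewrite /dcgd_step /U /gw (grad_avg (fi := fi) w f_def); last first.
    by move=> i z; have [_ + _] := fi_smooth i; exact.
  rewrite -scalerDr -big_split /=; congr (_ - _ *: (_ *: _)).
  by apply: eq_bigr => i _; rewrite addrC subrK.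
(* The completed square leaves [- X] on the right; adding [X] on the left instead keeps all
   integrands nonnegative. *)
pose X := (2 * L)^-1 * dot gx gx.
have X0 : 0 <= X by rewrite mulr_ge0 ?dotxx_ge0// invr_ge0 mulr_ge0// ltW.
pose Q om := 1 / (2 * gamma) * dot ((x - gamma *: gw - xs) + (- gamma) *: U om)
     ((x - gamma *: gw - xs) + (- gamma) *: U om)
   + ((f x - f xs) + L / 2 * dot ((gamma *: gw - L^-1 *: gx) + gamma *: U om)
       ((gamma *: gw - L^-1 *: gx) + gamma *: U om))
   + c * (1 - alpha) * dot ((x - gamma *: gw - w) + (- gamma) *: U om)
       ((x - gamma *: gw - w) + (- gamma) *: U om).
have pQ om : let x' := dcgd_step fi gamma (fun i => xiD i t om) x w in
    pot (c * (1 - alpha)) x' (x' - w) + X <= Q om.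
  by rewrite /= stepE; exact: potential_step_le.
have mx : measurable_fun setT ((fun=> x) : Omega -> V) by exact: measurable_cst.
have mw : measurable_fun setT ((fun=> w) : Omega -> V) by exact: measurable_cst.
have mstep := measurable_dcgd_step fi_smooth gamma
  (fun i => measurable_funPT (xiD i t)) mx mw.
have mpot := measurable_potential (c * (1 - alpha)) mstep (measurable_rVB mstep mw).
have p0 om : 0 <= let x' := dcgd_step fi gamma (fun i => xiD i t om) x w in
    pot (c * (1 - alpha)) x' (x' - w).
  by apply: potential_ge0; exact: damped_weight_ge0.
have mQ : measurable_fun setT Q.
  have mq (v : 'rV[R]_d) b :
      measurable_fun setT (fun om => dot (v + b *: U om) (v + b *: U om)).
    have mv : measurable_fun setT ((fun om => v + b *: U om) : Omega -> V).
      apply: measurable_rVD; first exact: measurable_cst.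
      exact: measurable_rVZ.
    exact: measurable_dot.
  by apply: measurable_funD; [apply: measurable_funD|];
    try apply: measurable_funD => //; apply: measurable_funM.
rewrite -(leeD2rE _ _ (isT : X%:E \is a fin_num)).
rewrite -[X in (_ + X <= _)%E](integral_probability_cst P) -ge0_integralD_RV//.
apply: (@le_trans _ _ (\int[P]_om (Q om)%:E)%E).
  apply: ge0_le_integral_RV => //; first exact: measurable_funD.
  by move=> om; rewrite addr_ge0.
have g0 : 0 <= 1 / (2 * gamma) by rewrite divr_ge0// mulr_ge0// ltW.
have L20 : 0 <= L / 2 by rewrite divr_ge0// ltW.
have D0 : 0 <= f x - f xs by rewrite subr_ge0.
apply: le_trans (noise_bound_quadratics (- gamma) gamma (- gamma) _ _ _ mU nU
  g0 L20 damped_weight_ge0 D0) _.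
rewrite sqrrN -EFinD lee_fin /potential.
move: main; rewrite -/X.
move=> main; rewrite -lerBlDr; apply: le_trans main.
by rewrite [leLHS]addrAC -(addrA _ _ (- X)).
Qed.

Variable (x0 : 'rV[R]_d).
Local Notation state :=
  (ef21p_dcgd fi (fun i s => xiD i s) (fun s => xiP s) gamma x0).

Lemma measurable_state (K : set (nat * option 'I_n)) t :
  (forall k, (k.1 < t)%N -> K k) ->
  measurable_fun setT
    ((fun om => (state t om).1) : g_sigma_algebraType (seed_sigma xiD xiP K) -> V) /\
  measurable_fun setT
    ((fun om => (state t om).2) : g_sigma_algebraType (seed_sigma xiD xiP K) -> V).
Proof.
move=> Kt; apply: (measurable_ef21p_dcgd fi_smooth).
  by move=> i s st; apply: measurable_xiD; exact: Kt.
by move=> s st; apply: measurable_xiP; exact: Kt.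
Qed.

Lemma measurable_stateT t :
  measurable_fun setT ((fun om => (state t om).1) : Omega -> V) /\
  measurable_fun setT ((fun om => (state t om).2) : Omega -> V).
Proof. exact: (measurable_ef21p_dcgd fi_smooth). Qed.

Let x' t om := dcgd_step fi gamma (fun i => xiD i t om) (state t om).1 (state t om).2.

Let measurable_x' t : measurable_fun setT (x' t : Omega -> V).
Proof.
have [mx mw] := measurable_stateT t.
exact: (measurable_dcgd_step fi_smooth gamma
  (fun i => measurable_funPT (xiD i t)) mx mw).
Qed.

Lemma expected_downlink t :
  (\int[P]_om (pot c (state t.+1 om).1
     ((state t.+1 om).2 - (state t.+1 om).1))%:E <=
   \int[P]_om (pot (c * (1 - alpha)) (x' t om) (x' t om - (state t om).2))%:E)%E.
Proof.
(* The point [x' t] already depends on the uplink seeds of time [t], so all seeds up to time [t] are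
   frozen except the one of [CP]. *)
pose K1 := [set k : nat * option 'I_n | (k.1 <= t)%N /\ k <> (t, None)].
pose K2 := [set k : nat * option 'I_n | k = (t, None)].
pose X om : V * V := (x' t om, (state t om).2).
pose h (z : V * V * seed CP) : \bar R := (pot c z.1.1
  ((z.1.2 : 'rV[R]_d) + cmap z.2 ((z.1.1 : 'rV[R]_d) - (z.1.2 : 'rV[R]_d))
     - (z.1.1 : 'rV[R]_d)))%:E.
have tK1 k : (k.1 < t)%N -> K1 k.
  by move=> kt; split; [exact: ltnW|move=> ke; rewrite ke ltnn in kt].
have [mx mw] := measurable_state tK1.
have mX : measurable_fun setT (X : g_sigma_algebraType (seed_sigma xiD xiP K1) -> _).
  apply: measurable_fun_pair => //.
  apply: (measurable_dcgd_step fi_smooth gamma) => // i.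
  by apply: measurable_xiD; split.
have mY : measurable_fun setT
    (xiP t : g_sigma_algebraType (seed_sigma xiD xiP K2) -> seed CP).
  exact: measurable_xiP.
have m1 : measurable_fun setT (fun z : V * V * seed CP => z.1.1 : V).
  exact: measurableT_comp.
have m2 : measurable_fun setT (fun z : V * V * seed CP => z.1.2 : V).
  exact: measurableT_comp.
have mh : measurable_fun setT h.
  apply/measurable_EFinP; apply: measurable_potential => //.
  apply: measurable_rVB => //; apply: measurable_rVD => //.
  by apply: measurable_cmap_comp => //; exact: measurable_rVB.
have h0 z : (0 <= h z)%E by rewrite lee_fin potential_ge0// weight_ge0.
have mphi : measurable_fun setT (fun om =>
    (pot (c * (1 - alpha)) (x' t om) (x' t om - (state t om).2))%:E).
  have [_ mw'] := measurable_stateT t.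
  apply/measurable_EFinP; apply: measurable_potential; first exact: measurable_x'.
  by apply: measurable_rVB => //; exact: measurable_x'.
have indep A B : <<s seed_sigma xiD xiP K1 >> A -> <<s seed_sigma xiD xiP K2 >> B ->
    P (A `&` B) = (P A * P B)%E.
  apply: seed_sigma_independent => //.
  by apply/seteqP; split => // k [[_ kn] ke].
have := integral_independent_sigma_le (seed_sigma_measurable (K := K1))
  (seed_sigma_measurable (K := K2)) indep mX mY mh h0 mphi
  (fun om => downlink_bound t (x' t om) (state t om).2).
apply: le_trans; rewrite le_eqVlt; apply/orP; left; apply/eqP.
by apply: eq_integral => om _; rewrite ef21p_dcgdS.
Qed.

Lemma expected_uplink t :
  (\int[P]_om (pot (c * (1 - alpha)) (x' t om) (x' t om - (state t om).2))%:E <=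
   \int[P]_om ((1 - gamma * mu / 2) * pot c (state t om).1
        ((state t om).2 - (state t om).1) + 4 * gamma * (omega / n%:R) * H)%:E)%E.
Proof.
pose K1 := [set k : nat * option 'I_n | (k.1 < t)%N].
pose K2 := [set k : nat * option 'I_n | k.1 = t].
pose X om : V * V := ((state t om).1, (state t om).2).
(* The n seeds drawn at time t are represented jointly by the identity map from
   Omega to Omega equipped with the sigma-algebra that they generate. *)
pose W := g_sigma_algebraType (seed_sigma xiD xiP K2).
pose h (z : V * V * W) : \bar R :=
  (let y := dcgd_step fi gamma (fun i => xiD i t z.2) z.1.1 z.1.2 in
   pot (c * (1 - alpha)) y (y - z.1.2))%:E.
have [mx mw] := @measurable_state K1 t (fun=> id).
have mX : measurable_fun setT (X : g_sigma_algebraType (seed_sigma xiD xiP K1) -> _).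
  exact: measurable_fun_pair.
have mY : measurable_fun setT (id : W -> W) by exact: measurable_id.
have m1 : measurable_fun setT (fun z : V * V * W => z.1.1 : V).
  exact: measurableT_comp.
have m2 : measurable_fun setT (fun z : V * V * W => z.1.2 : V).
  exact: measurableT_comp.
have mxi i : measurable_fun setT (fun z : V * V * W => xiD i t z.2).
  have mi : measurable_fun setT (xiD i t : W -> seed (CD i)).
    exact: measurable_xiD.
  exact: (measurableT_comp mi measurable_snd).
have my := measurable_dcgd_step fi_smooth gamma mxi m1 m2.
have mh : measurable_fun setT h.
  apply/measurable_EFinP; apply: measurable_potential => //.
  exact: measurable_rVB.
have h0 z : (0 <= h z)%E by rewrite lee_fin potential_ge0// damped_weight_ge0.
have [mx' mw'] := measurable_stateT t.
have mphi : measurable_fun setT (fun om => ((1 - gamma * mu / 2) *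
    pot c (state t om).1 ((state t om).2 - (state t om).1)
      + 4 * gamma * (omega / n%:R) * H)%:E).
  apply/measurable_EFinP; apply: measurable_funD => //.
  apply: measurable_funM => //; apply: measurable_potential => //.
  exact: measurable_rVB.
have indep A B : <<s seed_sigma xiD xiP K1 >> A -> <<s seed_sigma xiD xiP K2 >> B ->
    P (A `&` B) = (P A * P B)%E.
  apply: seed_sigma_independent => //.
  by apply/seteqP; split => // -[s o] [st ts];
    have : (s < t)%N := st; rewrite (ts : s = t) ltnn.
exact: (integral_independent_sigma_le (seed_sigma_measurable (K := K1))
  (seed_sigma_measurable (K := K2)) indep mX mY mh h0 mphi
  (fun om => uplink_bound t (state t om).1 (state t om).2)).
Qed.

(** The additive term is the fixed point of the recursion: [4 gamma omega H / n] is [gamma mu / 2]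
    times [8 omega H / (n mu)]. The induction carries it along, so no geometric sum appears. *)
Lemma expected_potential t :
  (\int[P]_om (pot c (state t om).1 ((state t om).2 - (state t om).1))%:E <=
   ((1 - gamma * mu / 2) ^+ t * pot 0 x0 0 + 8 * omega / (n%:R * mu) * H)%:E)%E.
Proof.
have np : 0 < n%:R :> R by rewrite ltr0n.
have H0 : 0 <= H.
  by rewrite mulr_ge0 ?invr_ge0 ?ler0n// sumr_ge0// => i _; exact: sqr_ge0.
have rho0 : 0 <= 1 - gamma * mu / 2.
  rewrite subr_ge0 ler_pdivrMr// mul1r.
  apply: le_trans (ler_wpM2l (ltW gamma_gt0) mu_le) _.
  apply: le_trans (_ : gamma * (100 * L) <= 2).
    apply: ler_wpM2l; first exact: ltW.
    by apply: ler_peMl; [exact: ltW|rewrite ler1n].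
  by apply: le_trans gamma_le2 (le_trans alpha_le1 _); rewrite ler1n.
elim: t => [|t IH].
  under eq_integral do rewrite /= subrr.
  rewrite integral_probability_cst lee_fin expr0 mul1r.
  rewrite /potential dot0l !mulr0 lerDl mulr_ge0// divr_ge0//; first exact: mulr_ge0.
  by rewrite mulr_ge0 ?ler0n// ltW.
apply: le_trans (expected_downlink t) _; apply: le_trans (expected_uplink t) _.
have [mx mw] := measurable_stateT t.
have mp := measurable_potential c mx (measurable_rVB mw mx).
have K0 : 0 <= 4 * gamma * (omega / n%:R) * H.
  by rewrite mulr_ge0// !mulr_ge0 ?invr_ge0 ?ler0n// ltW.
rewrite ge0_integralD_RV//; last 2 first.
  by apply: measurable_funM.
  by move=> om; rewrite mulr_ge0// potential_ge0// weight_ge0.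
rewrite integral_probability_cst ge0_integralZl_RV//; last first.
  by move=> om; rewrite potential_ge0// weight_ge0.
apply: le_trans (leeD2r _ (lee_wpmul2l _ IH)) _; first by rewrite lee_fin.
rewrite -EFinM -EFinD lee_fin exprS.
move: (_ ^+ t) (pot 0 x0 0) H => r p h.
rewrite le_eqVlt; apply/orP; left; apply/eqP; field.
by rewrite !lt0r_neq0.
Qed.

End OneStep.

Theorem theoremG3
  (R : realType) (d n : nat) (n_gt0 : (0 < n)%N)
  (fi : 'I_n -> 'rV[R]_d -> R) (f : 'rV[R]_d -> R)
  (f_def : forall x, f x = n%:R^-1 * \sum_(i < n) fi i x)
  (L : R) (f_smooth : smoothness_constant L f)
  (Li : 'I_n -> R) (fi_smooth : forall i, smoothness_constant (Li i) (fi i))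
  (Lmax : R) (Lmax_def : Lmax = \big[Num.max/0]_(i < n) Li i)
  (fi_convex : forall i, convex_on_space (fi i))
  (mu : R) (mu_gt0 : 0 < mu) (f_strongly_convex : strongly_convex mu f)
  (xs : 'rV[R]_d) (xs_min : forall x, f xs <= f x)
  (omega : R) (omega_ge0 : 0 <= omega)
  (CD : 'I_n -> stoch_map R d) (CD_U : forall i, compressor_U omega (CD i))
  (alpha : R) (alpha_gt0 : 0 < alpha) (alpha_le1 : alpha <= 1)
  (CP : stoch_map R d) (CP_B : compressor_B alpha CP)
  (dO : measure_display) (Omega : measurableType dO) (P : probability Omega R)
  (xiD : forall i : 'I_n, nat -> {RV P >-> seed (CD i)})
  (xiP : nat -> {RV P >-> seed CP})
  (xi_fresh : fresh_seeds xiD xiP)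
  (gamma : R) (gamma_gt0 : 0 < gamma)
  (gamma_le : (gamma%:E <= mine (frac_pinfty n%:R (160 * omega * Lmax))
                                (frac_pinfty alpha (100 * L)))%E)
  (x0 : 'rV[R]_d) (x : nat -> Omega -> 'rV[R]_d)
  (x_def : forall t om,
     x t om = (ef21p_dcgd fi (fun i s => xiD i s) (fun s => xiP s)
                 gamma x0 t om).1)
  (T : nat) :
  ((1 / (2 * gamma))%:E * 'E_P[fun om => (enorm (x T om - xs) ^+ 2)%R]
     + 'E_P[fun om => (f (x T om) - f xs)%R]
   <= ((1 - gamma * mu / 2) ^+ T)%:E
        * ((1 / (2 * gamma))%:E * 'E_P[fun om => (enorm (x 0%N om - xs) ^+ 2)%R]
           + (f x0 - f xs)%:E)
      + (8 * omega / (n%:R * mu)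
           * (n%:R^-1 * \sum_(i < n) enorm (grad (fi i) xs) ^+ 2))%:E)%E.
Proof.
have H0 : 0 <= n%:R^-1 * \sum_(i < n) enorm (grad (fi i) xs) ^+ 2.
  by rewrite mulr_ge0 ?invr_ge0 ?ler0n// sumr_ge0// => i _; exact: sqr_ge0.
have x0E om : x 0%N om = x0 by rewrite x_def.
have -> : ('E_P[fun om => (enorm (x 0%N om - xs) ^+ 2)%R] =
    (dot (x0 - xs) (x0 - xs))%:E)%E.
  rewrite unlock; under eq_integral do rewrite x0E enorm_sqr.
  exact: integral_probability_cst.
rewrite unlock -[((1 / (2 * gamma))%:E * (dot _ _)%:E)%E]EFinM -[in leRHS]EFinD.
(* In dimension 0 the smallest [L] is 0, so [mu <= L] fails; but all points coincide and the
   left-hand side is 0. *)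
have [d0|d_gt0] := posnP d.
  subst d.
  have dot0 (u v : 'rV[R]_0) : dot u v = 0 by rewrite /dot big_ord0.
  have all0 (u v : 'rV[R]_0) : u = v by apply/rowP => -[].
  under eq_integral do rewrite enorm_sqr dot0.
  under [X in (_ + X <= _)%E]eq_integral do rewrite (all0 (x T _) xs) subrr.
  rewrite !integral_probability_cst -EFinM -EFinD lee_fin.
  rewrite dot0 (all0 x0 xs) subrr !mulr0 !addr0 mulr0 add0r mulr_ge0//.
  by rewrite divr_ge0 ?mulr_ge0 ?ler0n// ltW.
have [f_sm _] := f_smooth.
have fi_sm i : smooth (Li i) (fi i) by have [] := fi_smooth i.
have mu_le := strongly_convex_le_smooth d_gt0 f_sm f_strongly_convex.
have L_gt0 := lt_le_trans mu_gt0 mu_le.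
have Li_le i : Li i <= Lmax by rewrite Lmax_def; exact: le_bigmax.
(* The maximum starts from the default 0, which leaves it unchanged since all [Li i] are
   nonnegative. *)
have Lmax_ge0 : 0 <= Lmax by rewrite Lmax_def bigmax_idl le_max lexx.
have fi_cv i := convex_strongly_convex0 (fi_convex i).
move: gamma_le; rewrite le_min => /andP[gamma_le1 gamma_le2].
have {}gamma_le1 : gamma * (160 * omega * Lmax) <= n%:R.
  by apply: le_frac_pinfty => //; rewrite ?ler0n ?mulr_ge0.
have {}gamma_le2 : gamma * (100 * L) <= alpha.
  by apply: le_frac_pinfty => //; rewrite ?mulr_ge0// ltW.
have := expected_potential n_gt0 f_def f_sm fi_sm Li_le fi_cv mu_gt0
  f_strongly_convex xs_min omega_ge0 CD_U alpha_gt0 alpha_le1 CP_B xi_fresh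
  gamma_gt0 L_gt0 mu_le gamma_le1 gamma_le2 x0 T.
rewrite {2}/potential mul0r addr0; apply: le_trans.
have [mx mw] := measurable_stateT fi_sm xiD xiP gamma x0 T.
have g0 : 0 <= 1 / (2 * gamma) by rewrite divr_ge0// mulr_ge0// ltW.
have mxT : measurable_fun setT (x T : Omega -> borel_rV R d).
  by rewrite (funext (x_def T)).
have md : measurable_fun setT (fun om => dot (x T om - xs) (x T om - xs)).
  by apply: measurable_dot; apply: measurable_rVB => //; exact: measurable_cst.
have mf : measurable_fun setT (fun om => f (x T om) - f xs).
  apply: measurable_funB => //.
  exact: (measurableT_comp (continuous_borel_rV (smooth_continuous f_sm)) mxT).
under eq_integral do rewrite enorm_sqr.
rewrite -ge0_integralZl_RV//; last by move=> om; exact: dotxx_ge0.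
rewrite -ge0_integralD_RV//; last 3 first.
- exact: measurable_funM.
- by move=> om; rewrite mulr_ge0// dotxx_ge0.
- by move=> om; rewrite subr_ge0.
(* The claim omits the term [4 L / alpha |w - x|^2] of the potential at time [T], which is
   nonnegative. *)
apply: ge0_le_integral_RV.
- by apply: measurable_funD => //; exact: measurable_funM.
- by apply: (measurable_potential f_sm); [|exact: measurable_rVB].
- by move=> om; rewrite addr_ge0// ?subr_ge0// mulr_ge0// dotxx_ge0.
- move=> om; rewrite x_def /potential lerDl mulr_ge0 ?dotxx_ge0//.
  by rewrite !mulr_ge0 ?invr_ge0// ltW.
Qed.
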